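(* Let $S=\begin{pmatrix}A&B\\ C&D\end{pmatrix}$ be a non-commuting switch with entries in a generalized quaternion algebra $\mathcal{Q}$. Then for every virtual link diagram $\mathcal{D}$ representing a classical knot or link, the invariant $\Delta_0=d(M)$ of the presentation matrix $M$ associated with $\mathcal{D}$ and $S$ is zero.
   Context: $\mathcal{Q}=\left(\frac{\lambda,\ \mu}{F}\right)$ is the $4$-dimensional associative algebra over a field $F$ of characteristic $\neq 2$ with basis $1,i,j,k$ and relations $i^2=\lambda,\ j^2=\mu,\ ij=-ji=k$ ($\lambda,\mu\in F$ nonzero). A non-commuting switch is a matrix $S=\begin{pmatrix}A&B\\ C&D\end{pmatrix}$ where $A,B\in\mathcal{Q}$ are such that $A$, $A-1$, $B$ are invertible, $AB\neq BA$, $A^{-1}B^{-1}AB-BA^{-1}B^{-1}A=B^{-1}AB-A$, and $C=A^{-1}B^{-1}A(1-A)$, $D=1-A^{-1}B^{-1}AB$. Determinant: let $\overline{F}$ be an algebraic closure of $F$; embed $\mathcal{Q}$ in $M_2(\overline{F})$ by $i\mapsto\begin{pmatrix}0&\sqrt{-\lambda}\\-\sqrt{-\lambda}&0\end{pmatrix}$, $j\mapsto\begin{pmatrix}0&\sqrt{\mu}\\ \sqrt{\mu}&0\end{pmatrix}$, $k\mapsto\begin{pmatrix}\sqrt{-\lambda\mu}&0\\0&-\sqrt{-\lambda\mu}\end{pmatrix}$ (with $\sqrt{-\lambda\mu}=\sqrt{-\lambda}\sqrt{\mu}$), hence $M_n(\mathcal{Q})\subset M_{2n}(\overline{F})$,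 and let $d:M_n(\mathcal{Q})\to\overline{F}$ be this embedding followed by the ordinary determinant. Virtual link diagrams: oriented immersed circles in the plane whose double points are either classical crossings (with over/under information, positive or negative) or virtual crossings; two diagrams are equivalent if related by the classical Reidemeister moves, the flat Reidemeister moves among virtual crossings, and the mixed move (an arc through two consecutive virtual crossings may be moved across a classical crossing). A classical knot or link is a class containing a diagram without virtual crossings. Presentation matrix: the semi-arcs of a diagram with $n$ classical crossings are the $2n$ pieces obtained by cutting at classical crossings only (virtual crossings are passed through). Assign a generator to each semi-arc. At each classical crossing, drawn so that both strands are oriented from west to east: if the crossing is positive let $a$ be the label at SW (under-strand input), $b$ at NW (over-strand input), $c$ at SE (over-strand output), $d$ at NE (under-strand output); if it is negative let $a$ be the label at SE, $b$ at NE, $c$ at SW, $d$ at NW. In both cases impose the two relations $c=Aa+Bb$, $d=Ca+Db$. Writing all $2n$ relations as $M\mathbf{x}=\mathbf{0}$, with $\mathbf{x}$ the vector of generators, gives the $2n\times 2n$ presentation matrix $M$ over $\mathcal{Q}$, and $\Delta_0=d(M)$.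
   Formalization: The diagram is assumed to have at least one classical crossing: for a diagram with none (such as the crossingless unknot) the presentation matrix is 0×0 and d(M)=1, so the claim fails there. *)

(* Defs.v *)
From HB Require Import structures.
From mathcomp Require Import all_boot all_order all_algebra.
From Stdlib Require Import Relations.
Unset Strict Implicit. Unset Printing Implicit Defensive.
Import Order.TTheory GRing.Theory Num.Theory.
Local Open Scope ring_scope.

Record quat (F : Type) := Quat { q0 : F; q1 : F; q2 : F; q3 : F }.
Arguments Quat {F}. Arguments q0 {F}. Arguments q1 {F}. Arguments q2 {F}. Arguments q3 {F}.

Section Quaternions.
Variables (F : fieldType) (lam mu : F).

Definition qzero : quat F := Quat 0 0 0 0.
Definition qone : quat F := Quat 1 0 0 0.
Definition qadd (x y : quat F) : quat F :=
  Quat (q0 x + q0 y) (q1 x + q1 y) (q2 x + q2 y) (q3 x + q3 y).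
Definition qopp (x : quat F) : quat F := Quat (- q0 x) (- q1 x) (- q2 x) (- q3 x).
Definition qsub (x y : quat F) : quat F := qadd x (qopp y).
(* i^2 = lam, j^2 = mu, ij = -ji = k  (so k^2 = -lam mu, jk = -mu i,
   kj = mu i, ki = -lam j, ik = lam j). *)
Definition qmul (x y : quat F) : quat F :=
  Quat (q0 x * q0 y + lam * q1 x * q1 y + mu * q2 x * q2 y
          - lam * mu * q3 x * q3 y)
       (q0 x * q1 y + q1 x * q0 y - mu * q2 x * q3 y + mu * q3 x * q2 y)
       (q0 x * q2 y + q2 x * q0 y + lam * q1 x * q3 y - lam * q3 x * q1 y)
       (q0 x * q3 y + q3 x * q0 y + q1 x * q2 y - q2 x * q1 y).

Definition is_qinv (x y : quat F) : Prop := qmul x y = qone /\ qmul y x = qone.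
Definition qunit (x : quat F) : Prop := exists y, is_qinv x y.

Definition switchC (A Ai Bi : quat F) : quat F :=
  qmul Ai (qmul Bi (qmul A (qsub qone A))).
Definition switchD (A B Ai Bi : quat F) : quat F :=
  qsub qone (qmul Ai (qmul Bi (qmul A B))).

Definition is_ncswitch (A B Ai Bi : quat F) : Prop :=
  [/\ is_qinv A Ai, is_qinv B Bi, qunit (qsub A qone), qmul A B <> qmul B A &
      qsub (qmul Ai (qmul Bi (qmul A B))) (qmul B (qmul Ai (qmul Bi A)))
      = qsub (qmul Bi (qmul A B)) A].

End Quaternions.
Arguments qadd {F}. Arguments qopp {F}. Arguments qsub {F}.
Arguments qmul {F}. Arguments is_qinv {F}. Arguments qunit {F}.
Arguments switchC {F}. Arguments switchD {F}. Arguments is_ncswitch {F}.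

(* Embedding Q -> M_2(K): i |-> [[0,s],[-s,0]], j |-> [[0,t],[t,0]],
   k |-> [[st,0],[0,-st]], where s = sqrt(-lam), t = sqrt(mu). *)
Definition qembed {F K : fieldType} (iota : F -> K) (s t : K) (q : quat F)
  : 'I_2 -> 'I_2 -> K :=
  fun i j =>
    if val i == 0%N then
      (if val j == 0%N then iota (q0 q) + iota (q3 q) * (s * t)
       else iota (q1 q) * s + iota (q2 q) * t)
    else
      (if val j == 0%N then - (iota (q1 q) * s) + iota (q2 q) * t
       else iota (q0 q) - iota (q3 q) * (s * t)).

Definition detT {T : finType} {R : comNzRingType} (f : T -> T -> R) : R :=
  \det (\matrix_(i < #|T|, j < #|T|) f (enum_val i) (enum_val j)).

Definition algebraic_over {F K : fieldType} (iota : {rmorphism F -> K}) : Prop :=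
  forall x : K, exists p : {poly F}, p != 0 /\ root (map_poly iota p) x.

(* Virtual link diagrams, as (signed) Gauss diagrams.                   *)
(* A diagram has a finite set [cr] of classical crossings; each crossing *)
(* c has two passages (c,true) (over) and (c,false) (under).  [nxt p] is *)
(* the passage following p along the oriented link; [free] is the number *)
(* of components with no classical crossing.  [sgn c] = true iff c is   *)
(* positive.  Virtual crossings carry no data (virtual / mixed moves do *)
(* not change this data), as in Goussarov-Polyak-Viro / Kauffman.       *)
(* The semi-arc leaving passage p (and arriving at nxt p) is named p.   *)
Record gdiag := GDiag {
  cr : finType;
  sgn : cr -> bool;
  nxt : cr * bool -> cr * bool;
  free : nat }.

Definition wf (D : gdiag) : Prop := injective (nxt D).

Definition prev (D : gdiag) (p : cr D * bool) : cr D * bool := finv (nxt D) p.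

(* The semi-arc labels (a, b, c, d) at crossing x, following the paper:
   positive: a = under-in, b = over-in, c = over-out, d = under-out;
   negative: a = SE = under-out, b = NE = over-out, c = SW = over-in,
             d = NW = under-in. *)
Definition lab_a (D : gdiag) (x : cr D) : cr D * bool :=
  if sgn D x then prev D (x, false) else (x, false).
Definition lab_b (D : gdiag) (x : cr D) : cr D * bool :=
  if sgn D x then prev D (x, true) else (x, true).
Definition lab_c (D : gdiag) (x : cr D) : cr D * bool :=
  if sgn D x then (x, true) else prev D (x, true).
Definition lab_d (D : gdiag) (x : cr D) : cr D * bool :=
  if sgn D x then (x, false) else prev D (x, false).

Definition qif {F : fieldType} (b : bool) (x : quat F) : quat F :=
  if b then x else qzero F.

Definition presmat {F : fieldType} (lam mu : F) (A B Ai Bi : quat F)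
  (D : gdiag) (r : cr D * bool) (g : cr D * bool) : quat F :=
  let x := r.1 in
  if r.2 then
    qadd (qadd (qif (lab_a D x == g) A) (qif (lab_b D x == g) B))
         (qopp (qif (lab_c D x == g) (qone F)))
  else
    qadd (qadd (qif (lab_a D x == g) (switchC lam mu A Ai Bi))
               (qif (lab_b D x == g) (switchD lam mu A B Ai Bi)))
         (qopp (qif (lab_d D x == g) (qone F))).

Definition Delta0 {F K : fieldType} (iota : F -> K) (s t : K) (lam mu : F)
  (A B Ai Bi : quat F) (D : gdiag) : K :=
  detT (fun u v : (cr D * bool) * 'I_2 =>
          qembed iota s t (presmat lam mu A B Ai Bi D u.1 v.1) u.2 v.2).

(* Darts: ((x, over?), out?) = the four ends of semi-arcs at crossing x. *)
Definition alpha (D : gdiag) (d : (cr D * bool) * bool) : (cr D * bool) * bool :=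
  if d.2 then (nxt D d.1, false) else (prev D d.1, true).

(* Counterclockwise rotation of the four ports at a crossing, as (over?, out?):
   positive: UO -> OI -> UI -> OO -> UO ; negative: OO -> UI -> OI -> UO -> OO *)
Definition rot (pos o out : bool) : bool * bool :=
  if pos then
    match o, out with
    | false, true => (true, false) | true, false => (false, false)
    | false, false => (true, true) | true, true => (false, true) end
  else
    match o, out with
    | true, true => (false, false) | false, false => (true, false)
    | true, false => (false, true) | false, true => (true, true) end.

Definition sigma (D : gdiag) (d : (cr D * bool) * bool) : (cr D * bool) * bool :=
  let r := rot (sgn D d.1.1) d.1.2 d.2 in ((d.1.1, r.1), r.2).

Definition face_perm (D : gdiag) (d : (cr D * bool) * bool) := sigma D (alpha D d).

Definition nfaces (D : gdiag) : nat := fcard (face_perm D) predT.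

Definition adj (D : gdiag) : rel (cr D) :=
  fun x y => [exists b : bool, ((nxt D (x, b)).1 == y) || ((nxt D (y, b)).1 == x)].

Definition ncomp (D : gdiag) : nat := n_comp (adj D) predT.

(* A diagram without virtual crossings: its canonical ribbon surface has
   genus 0 in every component (Euler: V - E + F = 2 per component, E = 2V). *)
Definition classical (D : gdiag) : Prop :=
  wf D /\ nfaces D = (#|cr D| + 2 * ncomp D)%N.

Definition extends (D D' : gdiag) (e : cr D -> cr D') : Prop :=
  [/\ injective e,
      (forall x, sgn D' (e x) = sgn D x),
      (forall p : cr D * bool, exists k : nat,
          iter k.+1 (nxt D') (e p.1, p.2) = (e (nxt D p).1, (nxt D p).2) /\
          forall j, (0 < j <= k)%N -> (iter j (nxt D') (e p.1, p.2)).1 \notin codom e) &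
      free D = (free D' +
        fcard (nxt D') [pred q | all (fun r => r.1 \notin codom e) (orbit (nxt D') q)])%N].

Definition tsw {T : eqType} (a b : T) (p : T) : T :=
  if p == a then b else if p == b then a else p.

(* R3: crossings x = (T,M), y = (T,B), z = (M,B); T over at x,y, M over at z. *)
Definition r3tau (D : gdiag) (x y z : cr D) (p : cr D * bool) : cr D * bool :=
  tsw (x, true) (y, true) (tsw (x, false) (z, true) (tsw (y, false) (z, false) p)).

Definition r3move (D : gdiag) (x y z : cr D) : gdiag :=
  GDiag (cr D) (sgn D) (fun p => r3tau D x y z (nxt D (r3tau D x y z p))) (free D).

(* sign of the crossing at a triangle vertex between edge X (before) and edge Y
   (after) in ccw order, dX dY = "directed ccw", overY = Y is the over strand *)
Definition vsign (dX dY overY : bool) : bool := (dX == dY) (+) overY.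

(* Geometric realizability of the triangle: there is a triangle of three
   oriented straight strands T (top), M (middle), B (bottom) with these signs
   and these orders along the strands.
   oT = x before y on T, oM = x before z on M, oB = y before z on B. *)
Definition r3_geom (sx sy sz oT oM oB : bool) : Prop :=
  exists ccw dT dM dB : bool,
    if ccw then (* ccw edge order T, M, B *)
      [/\ sx = vsign dT dM false, sz = vsign dM dB false, sy = vsign dB dT true &
          [/\ oT = ~~ dT, oM = dM & oB = ~~ dB]]
    else (* ccw edge order T, B, M *)
      [/\ sy = vsign dT dB false, sz = vsign dB dM true, sx = vsign dM dT true &
          [/\ oT = dT, oB = dB & oM = ~~ dM]].

Definition r3_ok (D : gdiag) (x y z : cr D) : Prop :=
  [/\ x != y, y != z, x != z &
      exists oT oM oB : bool,
        [/\ (if oT then nxt D (x, true) = (y, true) else nxt D (y, true) = (x, true)),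
            (if oM then nxt D (x, false) = (z, true) else nxt D (z, true) = (x, false)),
            (if oB then nxt D (y, false) = (z, false) else nxt D (z, false) = (y, false)) &
            r3_geom (sgn D x) (sgn D y) (sgn D z) oT oM oB]].

Inductive step : gdiag -> gdiag -> Prop :=
| step_iso (D D' : gdiag) (f : cr D -> cr D') :
    wf D -> wf D' -> bijective f -> (forall x, sgn D' (f x) = sgn D x) ->
    (forall p, nxt D' (f p.1, p.2) = (f (nxt D p).1, (nxt D p).2)) ->
    free D' = free D -> step D D'
| step_R1 (D D' : gdiag) (e : cr D -> cr D') (c : cr D') :
    wf D -> wf D' -> extends D D' e ->
    (forall c', (c' \in codom e) = (c' != c)) ->
    (nxt D' (c, true) = (c, false) \/ nxt D' (c, false) = (c, true)) ->
    step D D'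
| step_R2 (D D' : gdiag) (e : cr D -> cr D') (c1 c2 : cr D') :
    wf D -> wf D' -> extends D D' e -> c1 != c2 ->
    (forall c', (c' \in codom e) = (c' != c1) && (c' != c2)) ->
    sgn D' c1 != sgn D' c2 ->
    nxt D' (c1, true) = (c2, true) ->
    (nxt D' (c1, false) = (c2, false) \/ nxt D' (c2, false) = (c1, false)) ->
    step D D'
| step_R3 (D : gdiag) (x y z : cr D) :
    wf D -> r3_ok D x y z -> step D (r3move D x y z).

Definition vequiv : gdiag -> gdiag -> Prop := clos_refl_sym_trans gdiag step.

Definition represents_classical (D : gdiag) : Prop :=
  exists D0, classical D0 /\ vequiv D D0.

(* Main.v *)
(** Label the semi-arcs by elements of the ring 'M_2(K) and call a labelling a
colouring when it satisfies the switch relations; [Delta0] vanishes as soon as a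
nonzero colouring exists. On a planar diagram one is given by an Alexander
numbering: a semi-arc whose right-hand region has index n gets the label T ^ n with
T = B^-1 (1 - A), because S fixes every pair (v, T v). Nonzero colourings are
transported by Reidemeister moves since S is a linear biquandle. Crossing-free
components carry labels that the presentation matrix does not see, so the statement
that is transported has to speak of all sublinks: for every nonempty union of
components there is a nonzero colouring of that sublink. Erasing a strand is encoded
by an extra label that passes through crossings without interacting. On a planar
diagram the index function of a sublink exists because, by Euler's formula, every
cellular 1-cycle of a genus 0 surface is a boundary (over the rationals). *)

Require Import Defs.
From HB Require Import structures.
From mathcomp Require Import all_boot all_order all_algebra.
From mathcomp Require Import zify ring.
Set Implicit Arguments.
Unset Strict Implicit.
Import Order.TTheory GRing.Theory Num.Theory.
Local Open Scope ring_scope.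
Local Notation prev := Defs.prev.

(* [P a b c d]: at a positive crossing with under-strand a -> d and over-strand
   b -> c, i.e. S (a, b) = (c, d). The predicate [supp] tells the strands that are
   present from the erased ones, and [zero] plays the role of the trivial labels. *)
Record biquandle_rel (X : Type) (P : X -> X -> X -> X -> Prop) (supp zero : X -> bool)
    : Prop := BiquandleRel {
  bq_ab : forall a b, exists c d, P a b c d;
  bq_ac : forall a c, exists b d, P a b c d;
  bq_bd : forall b d, exists a c, P a b c d;
  bq_cd : forall c d, exists a b, P a b c d;
  bq_ab_uniq : forall a b c d c' d', P a b c d -> P a b c' d' -> c = c' /\ d = d';
  bq_ac_uniq : forall a c b d b' d', P a b c d -> P a b' c d' -> b = b' /\ d = d';
  bq_bd_uniq : forall b d a c a' c', P a b c d -> P a' b c' d -> a = a' /\ c = c';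
  bq_cd_uniq : forall c d a b a' b', P a b c d -> P a' b' c d -> a = a' /\ b = b';
  bq_YB : forall m0 t0 b0 t1 m1 t2 b1 m2 b2,
    P m0 t0 t1 m1 -> P b0 t1 t2 b1 -> P b1 m1 m2 b2 ->
    exists m1' b1' t1', [/\ P b0 m0 m1' b1', P b1' t0 t1' b2 & P m1' t1' t2 m2];
  bq_YB_sym : forall m0 t0 b0 m1 b1 t1 m2 t2 b2,
    P b0 m0 m1 b1 -> P b1 t0 t1 b2 -> P m1 t1 t2 m2 ->
    exists t1' m1' b1', [/\ P m0 t0 t1' m1', P b0 t1' t2 b1' & P b1' m1' m2 b2];
  bq_kink : forall a b c d, P a b c d -> (a = c <-> b = d);
  bq_kink_over : forall b, exists a, P a b a b;
  bq_kink_under : forall a, exists b, P a b a b;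
  bq_supp : forall a b c d, P a b c d -> supp b = supp c /\ supp a = supp d;
  bq_zero : forall a b c d, P a b c d -> zero b || zero c -> zero a || zero d ->
    [/\ zero a, zero b, zero c & zero d];
  bq_absent : exists x0, ~~ supp x0 /\ forall x, P x0 x x x0 /\ P x x0 x0 x;
  bq_absent_zero : forall x, ~~ supp x -> zero x;
  bq_ladder : exists v : int -> X, forall n,
    [/\ supp (v n), ~~ zero (v n) & P (v n) (v (n + 1)) (v n) (v (n + 1))] }.

Arguments bq_ab_uniq {X P supp zero} _ {a b c d c' d'}.
Arguments bq_ac_uniq {X P supp zero} _ {a c b d b' d'}.
Arguments bq_bd_uniq {X P supp zero} _ {b d a c a' c'}.
Arguments bq_cd_uniq {X P supp zero} _ {c d a b a' b'}.
Arguments bq_YB {X P supp zero} _ {m0 t0 b0 t1 m1 t2 b1 m2 b2}.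
Arguments bq_YB_sym {X P supp zero} _ {m0 t0 b0 m1 b1 t1 m2 t2 b2}.
Arguments bq_kink {X P supp zero} _ {a b c d}.
Arguments bq_supp {X P supp zero} _ {a b c d}.
Arguments bq_zero {X P supp zero} _ {a b c d}.

(** * Linear switches *)

Section Switch.
Variables (R : unitRingType) (A B : R).
Hypotheses (uA : A \is a GRing.unit) (uB : B \is a GRing.unit)
  (uA1 : 1 - A \is a GRing.unit).
Let P := A^-1 * B^-1 * A * B.
Definition swC := A^-1 * B^-1 * A * (1 - A).
Definition swD := 1 - A^-1 * B^-1 * A * B.
Hypothesis fundamental :
  A^-1 * B^-1 * A * B - B * A^-1 * B^-1 * A = B^-1 * A * B - A.
Local Notation C := swC.
Local Notation D := swD.

Let BP : B * P = B * A^-1 * B^-1 * A * B.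
Proof. by rewrite /P !mulrA. Qed.
Let AP : A * P = B^-1 * A * B.
Proof. by rewrite /P !mulrA divrr // mul1r. Qed.
Let BAP : B * A * P = A * B.
Proof. by rewrite -mulrA AP !mulrA divrr // mul1r. Qed.
(** This is [fundamental] rewritten in terms of [P]. It moves [B] past [P], and it is the form in
    which the hypothesis enters the computations below. *)
Let BPV : B * P / B = P + A - A * P.
Proof.
rewrite BP mulrK // AP; have := fundamental; rewrite -/P => e.
by rewrite -addrA -opprB -e opprB addrC subrK.
Qed.
Let BPe : B * P = (P + A - A * P) * B.
Proof. by rewrite -BPV divrK. Qed.
Let BAC : B * A * C = A * (1 - A).
Proof. by rewrite /swC !mulrA mulrK // divrr // mul1r. Qed.
Let BC : B * C = (P + A - A * P) * (1 - A).
Proof. by rewrite -BPV /swC /P !mulrA mulrK. Qed.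
Let CE : C = P / B * (1 - A).
Proof. by rewrite /P mulrK. Qed.
Let CB : C * B = P - P * A * P.
Proof. by rewrite -(mulrA P) AP CE mulrBr mulr1 mulrBl (divrK uB) !mulrA. Qed.
Let BAinvP X : A^-1 * B * A * (P * X) = B * X.
Proof. by rewrite /P !mulrA mulrK // mulrK // mulVr // mul1r. Qed.

(** This and the next six [sw_eq] lemmas compare coefficients in the Yang-Baxter equation for the
    linear map [S]: each one concerns a single input and a single output. The two remaining
    coefficients, [B * B] and [C * C], agree trivially. *)
Lemma sw_eqA : A * A + B * A * C = A.
Proof. by rewrite BAC mulrBr mulr1 addrC subrK. Qed.
Lemma sw_eqBA : A * B + B * A * D = B * A.
Proof. by rewrite /swD -/P mulrBr mulr1 BAP addrC subrK. Qed.
Lemma sw_eqAC : C * A + D * A * C = A * C.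
Proof.
suff -> : C * A = P * A * C by rewrite /swD -/P -mulrDl -mulrDl addrC subrK mul1r.
by rewrite /swC /P !mulrA !mulrK // -!mulrA (mulrBl A) (mulrBr A 1) mulr1 mul1r.
Qed.
Lemma sw_eqADA : C * B + D * A * D = A * D * A + B * C.
Proof.
rewrite CB BC /swD -/P !(mulrBl, mulrBr, mulr1, mul1r, mulrDl).
rewrite ?(opprB, opprD, opprK, addrA).
rewrite [LHS]+%R.[ACl 1*3*4*6*2*5]. rewrite subrK.
by rewrite [RHS]+%R.[ACl 3*4*5*8*1*6*2*7] subrK addrK.
Qed.
Lemma sw_eqDB : A * D * B + B * D = D * B.
Proof.
rewrite /swD -/P !(mulrBl, mulrBr, mulr1, mul1r).
rewrite BPe !(mulrBl, mulrDl) ?(opprB, opprD, opprK, addrA).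
by rewrite [LHS]+%R.[ACl 3*5*1*6*2*4] subrK addrK.
Qed.
(** Left multiplication by this unit turns a leading [P] into [B] and a leading [C] into [1 - A], so
    identities with many inverses become polynomial ones. *)
Let u : A^-1 * B * A \is a GRing.unit.
Proof. by rewrite unitrMr // unitrMl ?unitrV. Qed.
Let uC X : A^-1 * B * A * (C * X) = (1 - A) * X.
Proof. by rewrite mulrA -[X in X * C]mulrA -(mulrA _ _ C) BAC mulKr. Qed.
Lemma sw_eqCD : C * D * A + D * C = C * D.
Proof.
suff e : P * C = C * P + C * A - C * P * A.
  rewrite /swD -/P !(mulrBl, mulrBr, mulr1, mul1r) e -/P.
  rewrite ?(opprB, opprD, opprK, addrA).
  by rewrite [LHS]+%R.[ACl 3*5*1*6*2*4] subrK addrK.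
apply: (mulrI u); rewrite BAinvP BC; clearbody P.
rewrite [RHS]mulrBr [X in _ = X - _]mulrDr -(mulrA C) !uC.
rewrite !(mulrBl, mulrBr, mulr1, mul1r, mulrDl, mulrA).
rewrite ?(opprB, opprD, opprK, addrA).
by rewrite [RHS]+%R.[ACl 1*3*6*4*5*2].
Qed.
Lemma sw_eqD : C * D * B + D * D = D.
Proof.
suff e : C * D * B = P - P * P.
  rewrite e /swD -/P !(mulrBl, mulrBr, mulr1, mul1r).
  by rewrite addrC subrK.
apply: (mulrI u); rewrite /swD -/P -(mulrA C) uC [RHS]mulrBr BAinvP.
rewrite -{2}[P]mulr1 BAinvP mulr1 BPe; clearbody P.
rewrite !(mulrBl, mulrBr, mulr1, mul1r, mulrDl, mulrA).
rewrite ?(opprB, opprD, opprK, addrA).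
by rewrite (addrAC B).
Qed.

Lemma swC_unit : C \is a GRing.unit.
Proof. by rewrite !unitrMl ?unitrV. Qed.

(** Schur complement of [B] in [S]: eliminating b from S (a, b) = (c, d) leaves
    [swW * a = d - D * B^-1 * c]. Its invertibility makes (c, d) determine (a, b). *)
Definition swW := C - D * B^-1 * A.

Lemma swW_unit : swW \is a GRing.unit.
Proof.
have -> : swW = A^-1 * (1 - A) * B^-1 * A.
  rewrite /swW /swC /swD !(mulrBl, mulrBr, mulr1, mul1r) mulrK //.
  by rewrite mulVr // mul1r opprB addrA subrK.
by rewrite !unitrMl ?unitrV.
Qed.

(* [None] labels the strands outside the sublink under consideration. *)
Definition swrel (a b c d : option R) : Prop :=
  match a, b with
  | Some a, Some b => c = Some (A * a + B * b) /\ d = Some (C * a + D * b)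
  | _, _ => c = b /\ d = a
  end.

Lemma swrel_ab a b : exists c d, swrel a b c d.
Proof. by case: a b => [a|] [b|]; do 2 eexists; split. Qed.

Lemma swrel_ab_uniq a b c d c' d' :
  swrel a b c d -> swrel a b c' d' -> c = c' /\ d = d'.
Proof. by case: a b => [a|] [b|] /= [-> ->] [-> ->]. Qed.

Lemma swrel_ac a c : exists b d, swrel a b c d.
Proof.
case: a c => [a|] [c|].
- exists (Some (B^-1 * (c - A * a))); eexists; split; last by [].
  by rewrite mulVKr // addrC subrK.
- by exists None, (Some a).
- by exists (Some c), None.
by exists None, None.
Qed.

Lemma swrel_ac_uniq a b c d b' d' :
  swrel a b c d -> swrel a b' c d' -> b = b' /\ d = d'.
Proof.
case: a b b' => [a|] [b|] [b'|] /= [-> ->] //; try by case.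
- by move=> [] [] /addrI /(mulrI uB) -> ->.
Qed.

Lemma swrel_bd b d : exists a c, swrel a b c d.
Proof.
case: b d => [b|] [d|].
- exists (Some (C^-1 * (d - D * b))); eexists; split; first by [].
  by rewrite mulVKr ?swC_unit // subrK.
- by exists None, (Some b).
- by exists (Some d), None.
by exists None, None.
Qed.

Lemma swrel_bd_uniq b d a c a' c' :
  swrel a b c d -> swrel a' b c' d -> a = a' /\ c = c'.
Proof.
case: b a a' => [b|] [a|] [a'|] /= [-> ->] //; try by case.
- by move=> [] -> [] /addIr /(mulrI swC_unit) ->.
Qed.

Lemma swrel_cd c d : exists a b, swrel a b c d.
Proof.
case: c d => [c|] [d|].
- pose a := swW^-1 * (d - D * B^-1 * c); exists (Some a), (Some (B^-1 * (c - A * a))).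
  split; first by rewrite mulVKr // addrC subrK.
  congr Some.
  have e x : D * (B^-1 * (c - A * x)) = D * B^-1 * c - D * B^-1 * A * x.
    by rewrite !mulrA mulrBr mulrA.
  rewrite e addrCA -mulrBl -/swW /a.
  by rewrite mulVKr ?swW_unit // addrC subrK.
- by exists None, (Some c).
- by exists (Some d), None.
by exists None, None.
Qed.

Lemma swrel_cd_uniq c d a b a' b' :
  swrel a b c d -> swrel a' b' c d -> a = a' /\ b = b'.
Proof.
have key x y : D * y = D * B^-1 * (A * x + B * y) - D * B^-1 * A * x.
  by rewrite mulrDr !mulrA addrAC subrr add0r divrK.
case: a b a' b' => [a|] [b|] [a'|] [b'|] /= [-> ->] //; try by case.
- move=> [] [e1] [e2].
  have ea : a = a'.
    move: e2; rewrite (key a b) (key a' b') e1 ![C * _ + _]addrCA.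
    by move/addrI; rewrite -!mulrBl => /(mulrI swW_unit).
  by move: e1; rewrite ea => /addrI /(mulrI uB) ->.
Qed.

(** If one of the strands is absent, the other two do not notice it and the witnesses are immediate.
    With three strands present, the outputs are compared coefficient by coefficient through the
    seven identities. *)
Lemma swrel_YB m0 t0 b0 t1 m1 t2 b1 m2 b2 :
  swrel m0 t0 t1 m1 -> swrel b0 t1 t2 b1 -> swrel b1 m1 m2 b2 ->
  exists m1' b1' t1',
    [/\ swrel b0 m0 m1' b1', swrel b1' t0 t1' b2 & swrel m1' t1' t2 m2].
Proof.
case: m0 t0 b0 => [m0|] [t0|] [b0|] /= [-> ->] /= [-> ->] /= [-> ->] /=;
  try by do 3 eexists.
exists (Some (A * b0 + B * m0)), (Some (C * b0 + D * m0)).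
exists (Some (A * (C * b0 + D * m0) + B * t0)); split; first by [].
- split; first by [].
  move: sw_eqCD sw_eqD; rewrite ?/swrel; move: swC swD => X Y e6 e7; congr Some.
  rewrite !(mulrDr, mulrDl, mulrA) -addrA addrACA -!mulrDl e6 e7.
  by rewrite addrA.
- rewrite /swrel; move: sw_eqA sw_eqBA sw_eqAC sw_eqADA sw_eqDB; move: swC swD => X Y e1 e2 e3 e4 e5.
  split; congr Some; rewrite !(mulrDr, mulrDl, mulrA).
    by rewrite [RHS]addrA [X in _ = X + _]addrACA -!mulrDl e1 e2 addrA.
  rewrite -[LHS]addrA [X in _ + X = _]addrACA. rewrite -!mulrDl e5.
  by rewrite [RHS]addrA [X in _ = X + _]addrACA -!mulrDl e3 e4 addrA.
Qed.

(** Both sides of the equation are functions of the same three inputs. The other side is computed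
    forwards, [swrel_YB] is applied to it, and uniqueness identifies the result with the given
    labels. *)
Lemma swrel_YB_sym m0 t0 b0 m1 b1 t1 m2 t2 b2 :
  swrel b0 m0 m1 b1 -> swrel b1 t0 t1 b2 -> swrel m1 t1 t2 m2 ->
  exists t1' m1' b1',
    [/\ swrel m0 t0 t1' m1', swrel b0 t1' t2 b1' & swrel b1' m1' m2 b2].
Proof.
move=> h1 h2 h3.
have [u1 [u2 k1]] := swrel_ab m0 t0; have [u3 [u4 k2]] := swrel_ab b0 u1.
have [u5 [u6 k3]] := swrel_ab u4 u2.
have [x [y [z [g1 g2 g3]]]] := swrel_YB k1 k2 k3.
have [ex ey] := swrel_ab_uniq g1 h1; subst x y.
have [ez e2] := swrel_ab_uniq g2 h2; subst z u6.
have [e3 e5] := swrel_ab_uniq g3 h3; subst u3 u5.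
by exists u1, u2, u4.
Qed.

(** For present strands both equalities amount to [B * b = (1 - A) * a]; for the second one, use
    [1 - D = P] and [C = P / B * (1 - A)] with [P] invertible. *)
Lemma swrel_kink a b c d : swrel a b c d -> (a = c <-> b = d).
Proof.
case: a b => [a|] [b|] /= [-> ->]; try by split.
have uP : P \is a GRing.unit by rewrite !unitrMl ?unitrV.
have e1 : a = A * a + B * b <-> B * b = (1 - A) * a.
  rewrite mulrBl mul1r; split=> [e|->]; first by rewrite {1}e addrAC subrr add0r.
  by rewrite addrC subrK.
have e2 : b = C * a + D * b <-> B * b = (1 - A) * a.
  have -> : C * a = P * (B^-1 * ((1 - A) * a)).
    by rewrite CE -2!(mulrA P) -(mulrA B^-1).
  rewrite /swD -/P (mulrBl b) mul1r addrCA -mulrBr.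
  split=> [e|<-]; last by rewrite mulKr // subrr mulr0 addr0.
  have : P * (B^-1 * ((1 - A) * a) - b) = 0 by apply: (addrI b); rewrite -e addr0.
  by move/(canRL (mulKr uP)); rewrite mulr0 => /subr0_eq <-; rewrite mulVKr.
by split=> [[/e1/e2 <-]|[/e2/e1 <-]].
Qed.

Definition swshift := B^-1 * (1 - A).

(* This fixed pair is what makes Alexander numberings into colourings. *)
Lemma swrel_shift v : swrel (Some v) (Some (swshift * v)) (Some v) (Some (swshift * v)).
Proof.
have [b [d h]] := swrel_ac (Some v) (Some v).
have /(swrel_kink h) := erefl (Some v) => e; subst d.
case: b h => [b|] h; last by case: h.
have [[e1] _] := h.
suff -> : swshift * v = b by [].
rewrite /swshift -mulrA (mulrBl v) mul1r {1}e1.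
by rewrite addrAC subrr add0r mulKr.
Qed.

Lemma swrel_kink_over p : exists q, swrel q p q p.
Proof.
case: p => [p|]; last by exists None.
exists (Some ((1 - A)^-1 * (B * p))).
have := swrel_shift ((1 - A)^-1 * (B * p)).
by rewrite /swshift -mulrA mulVKr // mulKr.
Qed.

Lemma swrel_kink_under p : exists q, swrel p q p q.
Proof.
case: p => [p|]; last by exists None.
by exists (Some (swshift * p)); apply: swrel_shift.
Qed.

Lemma swrel_supp a b c d : swrel a b c d -> isSome b = isSome c /\ isSome a = isSome d.
Proof. by case: a b => [a|] [b|] [-> ->]. Qed.

(** [None] counts as zero, so an absent strand never witnesses that a colouring is nonzero. *)
Definition zlab (a : option R) := odflt 0 a == 0.

(** One end of each strand is a pair that determines the other two labels, and four zero labels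
    satisfy the relation. *)
Lemma swrel_zero a b c d : swrel a b c d -> zlab b || zlab c -> zlab a || zlab d ->
  [/\ zlab a, zlab b, zlab c & zlab d].
Proof.
case: a b => [a|] [b|] h; try by case: h => -> ->; rewrite !orbb => ? ?; split.
case: c d h => [c|] [d|] h; try by case: h.
have s0 : swrel (Some 0) (Some 0) (Some 0) (Some 0).
  by split; rewrite !mulr0 addr0.
have z0 : zlab (Some 0) by rewrite /zlab /=.
case/orP=> /eqP /= e1 /orP[] /eqP /= e2; subst.
- by have [-> ->] := swrel_ab_uniq h s0.
- by have [-> ->] := swrel_bd_uniq h s0.
- by have [-> ->] := swrel_ac_uniq h s0.
by have [-> ->] := swrel_cd_uniq h s0.
Qed.

Lemma swrel_biquandle : biquandle_rel swrel isSome zlab.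
Proof.
split.
- exact: swrel_ab.
- exact: swrel_ac.
- exact: swrel_bd.
- exact: swrel_cd.
- by move=> *; apply: swrel_ab_uniq; eassumption.
- by move=> *; apply: swrel_ac_uniq; eassumption.
- by move=> *; apply: swrel_bd_uniq; eassumption.
- by move=> *; apply: swrel_cd_uniq; eassumption.
- exact: swrel_YB.
- exact: swrel_YB_sym.
- exact: swrel_kink.
- exact: swrel_kink_over.
- exact: swrel_kink_under.
- exact: swrel_supp.
- exact: swrel_zero.
- by exists None; split=> // -[x|].
- by case=> // _; rewrite /zlab /=.
(* The exponent runs over all integers because [swshift] is a unit; its powers are units, hence
   nonzero. *)
exists (fun n => Some (swshift ^ n)) => n.
have us : swshift \is a GRing.unit by rewrite unitrMl ?unitrV.
split=> //.
  by rewrite /zlab /=; apply: contraTneq (unitrXz n us) => ->; rewrite unitr0.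
by rewrite addrC exprzDr // expr1z; apply: swrel_shift.
Qed.

End Switch.

(** * Potentials on planar diagrams *)

Lemma sum_enum_delta (R : pzSemiRingType) (T : finType) (F : 'I_#|T| -> R) (a : T) :
  \sum_j F j * (enum_val j == a)%:R = F (enum_rank a).
Proof.
rewrite (bigD1 (enum_rank a)) //= enum_rankK eqxx mulr1 big1 ?addr0 // => j nj.
case: eqP => [e|_]; last by rewrite mulr0.
by rewrite -e enum_valK eqxx in nj.
Qed.

(** The rows are the indicator functions of the components of [e], pulled back along [pi]. For
    symmetric connectivity the row space consists of the functions on [T] that factor through [pi]
    and a function constant on components. *)
Definition comp_mx (T T' : finType) (e : rel T') (pi : T -> T') :
    'M[rat]_(#|roots e|, #|T|) :=
  \matrix_(i, j) (fingraph.root e (pi (enum_val j)) == enum_val i)%:R.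

(** Evaluation at the root of each component is a right inverse. *)
Lemma comp_mx_free (T : finType) (e : rel T) : connect_sym e ->
  row_free (comp_mx e (@id T)).
Proof.
move=> se; apply/row_freeP.
exists (\matrix_(j < #|T|, i < #|roots e|) (enum_val j == enum_val i)%:R).
apply/matrixP=> i i'; rewrite !mxE.
under eq_bigr do rewrite !mxE.
rewrite (sum_enum_delta (fun j => (fingraph.root e (enum_val j) == enum_val i)%:R)) enum_rankK.
have /eqP -> : fingraph.root e (enum_val i') == enum_val i' by apply: (enum_valP i').
by rewrite (inj_eq enum_val_inj) eq_sym.
Qed.

Lemma sub_comp_mx (T T' : finType) (e : rel T') (pi : T -> T') (u : T' -> rat)
    (v : 'rV_#|T|) : connect_sym e -> (forall x y, e x y -> u x = u y) ->
  (forall t, v 0 (enum_rank t) = u (pi t)) -> (v <= comp_mx e pi)%MS.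
Proof.
move=> se ue vu; apply/submxP; exists (\row_i u (enum_val i)).
apply/rowP=> j; rewrite !mxE.
have uroot x : u x = u (fingraph.root e x).
  have /connectP[p + ->] := connect_root e x.
  by elim: p x => //= y p IH x /andP[/ue -> /IH].
have r : fingraph.root e (pi (enum_val j)) \in roots e by rewrite -topredE /= roots_root.
rewrite -[j in LHS]enum_valK vu uroot (bigD1 (enum_rank_in r (fingraph.root e (pi (enum_val j))))) //=.
rewrite !mxE enum_rankK_in // eqxx mulr1 big1 ?addr0 // => i ni.
rewrite !mxE; case: eqP => [e1|_]; last by rewrite mulr0.
by case/eqP: ni; apply: enum_val_inj; rewrite enum_rankK_in.
Qed.

Lemma comp_mx_inv (T T' : finType) (e : rel T') (pi : T -> T') (v : 'rV_#|T|) x y :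
  connect_sym e -> e (pi x) (pi y) -> (v <= comp_mx e pi)%MS ->
  v 0 (enum_rank x) = v 0 (enum_rank y).
Proof.
move=> se exy /submxP[c ->]; rewrite !mxE; apply: eq_bigr => i _.
rewrite !mxE !enum_rankK; congr (_ * (_ == _)%:R); apply/eqP.
by rewrite root_connect // connect1.
Qed.

Section Planar.
Variable D : gdiag.
Hypothesis wD : wf D.
Local Notation psg := (cr D * bool)%type.
Local Notation dart := (cr D * bool * bool)%type.

Let nxtK : cancel (nxt D) (prev D). Proof. exact: finv_f. Qed.
Let prevK : cancel (prev D) (nxt D). Proof. exact: f_finv. Qed.

Let alphaK : involutive (alpha D).
Proof. by case=> p [] /=; rewrite /alpha /= ?nxtK ?prevK. Qed.

Let adj_sym : connect_sym (adj D).
Proof.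
by apply: sym_connect_sym => x y; apply: eq_existsb => b; rewrite orbC.
Qed.

Let sigma_inj : injective (sigma D).
Proof.
case=> [[x o] b] [[x' o'] b']; rewrite /sigma /= => -[<-].
by case: (sgn D x) o b o' b' => [] [] [] [] [].
Qed.

Let face_sym : connect_sym (frel (face_perm D)).
Proof. by apply: fconnect_sym => d d' /sigma_inj /(inv_inj alphaK). Qed.

(* [v *m bdry] is the jump of the face function [v] across each semi-arc, and
   [w *m div] the net flow of [w] out of each crossing. *)
Let bdry : 'M[rat]_(#|{: dart}|, #|{: psg}|) :=
  \matrix_(j, k) ((enum_val j == alpha D (enum_val k, true))%:R
                  - (enum_val j == (enum_val k, true))%:R).

Let div : 'M[rat]_(#|{: psg}|, #|cr D|) :=
  \matrix_(k, x) (((enum_val k).1 == enum_val x)%:R - ((nxt D (enum_val k)).1 == enum_val x)%:R).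

Let bdryE (v : 'rV_#|{: dart}|) k : (v *m bdry) 0 k =
  v 0 (enum_rank (alpha D (enum_val k, true))) - v 0 (enum_rank (enum_val k, true)).
Proof.
rewrite mxE; under eq_bigr do rewrite mxE mulrBr.
by rewrite sumrB !(sum_enum_delta (fun j => v 0 j)).
Qed.

Let sum_at (F : psg -> rat) y :
  \sum_p F p * (p.1 == y)%:R = \sum_b F (y, b).
Proof.
transitivity (\sum_x \sum_b F (x, b) * (x == y)%:R).
  by rewrite pair_bigA; apply: eq_bigr => -[a b] _.
rewrite (bigD1 y) //= [X in _ + X]big1 ?addr0 => [|x nx].
  by apply: eq_bigr => b _; rewrite eqxx mulr1.
by apply: big1 => b _; rewrite (negPf nx) mulr0.
Qed.

Let divE (w : 'rV_#|{: psg}|) x : (w *m div) 0 x =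
  \sum_b (w 0 (enum_rank (enum_val x, b)) - w 0 (enum_rank (prev D (enum_val x, b)))).
Proof.
rewrite mxE sumrB.
under eq_bigr do rewrite mxE mulrBr.
rewrite sumrB; congr (_ - _).
  rewrite (reindex (@enum_rank psg)) /=; last exact/onW_bij/enum_rank_bij.
  by under eq_bigr do rewrite enum_rankK; rewrite (sum_at (fun p => w 0 (enum_rank p))).
have prev_bij : bijective (prev D) by exists (nxt D).
rewrite (reindex (fun p => enum_rank (prev D p))) /=; last first.
  exact/onW_bij/(bij_comp (@enum_rank_bij psg) prev_bij).
under eq_bigr do rewrite enum_rankK prevK.
by rewrite (sum_at (fun p => w 0 (enum_rank (prev D p)))).
Qed.

Let faces := comp_mx (frel (face_perm D)) (@id dart).

Let face_inv (v : 'rV_#|{: dart}|) d : (v <= faces)%MS ->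
  v 0 (enum_rank (sigma D d)) = v 0 (enum_rank (alpha D d)).
Proof.
move=> sv; symmetry; apply: (comp_mx_inv (e := frel (face_perm D)) (pi := @id dart)) => //=.
by rewrite /face_perm alphaK.
Qed.

(** A boundary is a cycle: for a face function the net flow at a crossing is its sum over the
    [sigma]-images of the four ports minus its sum over the ports, and [sigma] permutes them. *)
Let faces_closed : (faces *m bdry <= kermx div)%MS.
Proof.
apply/sub_kermxP/row_matrixP => i; rewrite row0 !row_mul.
set v := row i faces; have sv : (v <= faces)%MS by apply: row_sub.
apply/rowP=> x; rewrite divE mxE big_bool /= !bdryE !enum_rankK.
have aE p : alpha D (prev D p, true) = (p, false) by rewrite /alpha /= prevK.
have aE' p : (prev D p, true) = alpha D (p, false) by [].
rewrite !aE !aE' -!face_inv //= /sigma /=.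
by case: (sgn D (enum_val x)) => /=; ring.
Qed.

Let ports (v : dart -> rat) : (forall d, v (sigma D d) = v d) ->
  forall x o b, v (x, o, b) = v (x, true, true).
Proof.
move=> vs x; have h o b := vs (x, o, b).
move: (h true true) (h true false) (h false true) (h false false); rewrite /sigma /=.
by case: (sgn D x) => /= e1 e2 e3 e4 [] []; congruence.
Qed.

(* A face function without jumps is constant on connected components. *)
Let rank_faces_ker : (\rank (kermx (faces *m bdry)) <= #|roots (adj D)|)%N.
Proof.
(* Since the rows of [faces] are independent, the kernel keeps its rank when it is viewed as a space
   of functions on darts. *)
rewrite -(mxrankMfree _ (comp_mx_free face_sym)) -/faces.
apply: leq_trans (mxrankS _) (rank_leq_row (comp_mx (adj D) (fun d : dart => d.1.1))).
apply/row_subP => i; set v := row i _.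
have sv : (v <= faces)%MS by rewrite /v row_mul submxMl.
have vb : v *m bdry = 0.
  by rewrite /v -row_mul -mulmxA mulmx_ker row0.
pose f d := v 0 (enum_rank d).
have va d : f (alpha D d) = f d.
  have h p : f (alpha D (p, true)) = f (p, true).
    have := bdryE v (enum_rank p); rewrite vb mxE enum_rankK => /esym/eqP.
    by rewrite subr_eq0 => /eqP.
  case: d => p [] //; have e : (p, false) = alpha D (prev D p, true).
    by rewrite /alpha /= prevK.
  by rewrite e alphaK -h.
have vs d : f (sigma D d) = f d by rewrite -[RHS]va; apply: face_inv.
have vp := ports vs.
apply: (sub_comp_mx (u := fun x => f (x, true, true))) => //.
  have half x y b : (nxt D (x, b)).1 = y -> f (x, true, true) = f (y, true, true).
    move=> <-; rewrite -(vp x b true) -va /alpha /=.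
    by case: (nxt D (x, b)) => x' b'; rewrite vp.
  by move=> x y /existsP[b /orP[]] /eqP /half.
by move=> [[x o] b]; rewrite -/(f _) vp.
Qed.

(** A function on crossings killed by the transpose of [div] takes equal values at both ends of
    every semi-arc, so it is constant on components. *)
Let rank_div_coker : (#|cr D| - \rank div <= #|roots (adj D)|)%N.
Proof.
rewrite -mxrank_tr -mxrank_ker.
apply: leq_trans (mxrankS _) (rank_leq_row (comp_mx (adj D) (@id (cr D)))).
apply/row_subP => i; set g := row i _.
have gd : g *m div^T = 0 by rewrite /g -row_mul mulmx_ker row0.
clearbody g.
apply: (sub_comp_mx (u := fun x => g 0 (enum_rank x))) => //.
have half p : g 0 (enum_rank p.1) = g 0 (enum_rank (nxt D p).1).
  have := congr1 (fun M : 'rV__ => M 0 (enum_rank p)) gd; rewrite !mxE => /eqP.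
  under eq_bigr do rewrite !mxE enum_rankK mulrBr (eq_sym p.1) (eq_sym (nxt D p).1).
  by rewrite sumrB !(sum_enum_delta (fun j => g 0 j)) subr_eq0 => /eqP.
by move=> x y /existsP[b /orP[]] /eqP <-; rewrite -half.
Qed.

(** Dimension count with V crossings and c components: the cycles have dimension at most 2V - (V -
    c) = V + c, while the boundaries have dimension at least (V + 2c) - c = V + c. Boundaries are
    cycles, so the two spaces coincide and the cycle [w] is the jump of a face function. *)
Lemma planar_potential : nfaces D = (#|cr D| + 2 * ncomp D)%N ->
  forall w : psg -> rat,
  (forall x, w (x, true) + w (x, false) = w (prev D (x, true)) + w (prev D (x, false))) ->
  exists f : dart -> rat, (forall d, f (sigma D d) = f (alpha D d)) /\
    forall p, f (alpha D (p, true)) = f (p, true) + w p.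
Proof.
move=> euler w w_div.
have ef : nfaces D = #|roots (frel (face_perm D))|.
  by apply: eq_card => d; rewrite !inE andbT.
have ec : ncomp D = #|roots (adj D)| by apply: eq_card => d; rewrite !inE andbT.
have sub : (kermx div <= faces *m bdry)%MS.
  rewrite -(mxrank_leqif_sup faces_closed) eqn_leq mxrankS //=.
  have -> : \rank (kermx div) = (#|cr D| * 2 - \rank div)%N.
    by rewrite mxrank_ker; congr (_ - _)%N; rewrite card_prod card_bool.
  have := rank_faces_ker; have := rank_div_coker; rewrite mxrank_ker.
  have := rank_leq_row (faces *m bdry); have := rank_leq_col div.
  have arith (V c nf r1 r2 : nat) : (nf = V + 2 * c -> r2 <= V -> r1 <= nf ->
    V - r2 <= c -> nf - r1 <= c -> V * 2 - r2 <= r1)%N by lia.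
  by apply: arith; rewrite -ef -ec.
pose v : 'rV[rat]_#|{: psg}| := \row_j w (enum_val j).
have : (v <= kermx div)%MS.
  apply/sub_kermxP/rowP => x; rewrite divE big_bool mxE /= !mxE !enum_rankK.
  rewrite addrACA w_div -opprD subrr //.
move/submx_trans/(_ sub)/submxP => [c]; rewrite mulmxA => ev.
have sv : (c *m faces <= faces)%MS by apply: submxMl.
exists (fun d => (c *m faces) 0 (enum_rank d)); split=> [d|p]; first exact: face_inv.
have -> : w p = v 0 (enum_rank p) by rewrite mxE enum_rankK.
by rewrite ev bdryE enum_rankK addrC subrK.
Qed.
End Planar.

Set Strict Implicit.

(** * Colourings and Reidemeister moves *)

Section Coloring.
Variables (X : Type) (P : X -> X -> X -> X -> Prop) (supp zero : X -> bool).
Hypothesis bq : biquandle_rel P supp zero.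

(** A negative crossing carries the positive relation read against the orientation of both
    strands. *)
Definition crossrel (s : bool) (oi ui oo uo : X) : Prop :=
  if s then P ui oi oo uo else P uo oo oi ui.

(* Labels [t0 t1 t2], [m0 m1 m2], [b0 b1 b2] are met in this order along the top,
   middle and bottom strands. *)
Definition triangle (sx sy sz oT oM oB : bool) (t0 t1 t2 m0 m1 m2 b0 b1 b2 : X) : Prop :=
  let i (f : bool) u v : X := if f then u else v in
  [/\ crossrel sx (i oT t0 t1) (i oM m0 m1) (i oT t1 t2) (i oM m1 m2),
      crossrel sy (i (~~ oT) t0 t1) (i oB b0 b1) (i (~~ oT) t1 t2) (i oB b1 b2) &
      crossrel sz (i (~~ oM) m0 m1) (i (~~ oB) b0 b1) (i (~~ oM) m1 m2) (i (~~ oB) b1 b2)].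

Ltac uniq_subst := repeat match goal with
  | h : P ?a ?b _ _, h' : P ?a ?b _ _ |- _ =>
      destruct (bq_ab_uniq bq h h'); clear h'; subst
  | h : P ?a _ ?c _, h' : P ?a _ ?c _ |- _ =>
      destruct (bq_ac_uniq bq h h'); clear h'; subst
  | h : P _ ?b _ ?d, h' : P _ ?b _ ?d |- _ =>
      destruct (bq_bd_uniq bq h h'); clear h'; subst
  | h : P _ _ ?c ?d, h' : P _ _ ?c ?d |- _ =>
      destruct (bq_cd_uniq bq h h'); clear h'; subst
  end.
Ltac finish := uniq_subst; do 3 eexists; split; eassumption.
Ltac useI h1 h2 h3 := destruct (bq_YB bq h1 h2 h3) as (? & ? & ? & [? ? ?]); finish.
Ltac useII h1 h2 h3 := destruct (bq_YB_sym bq h1 h2 h3) as (? & ? & ? & [? ? ?]); finish.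

(* Every oriented third move is the braid-like one after completing the two crossings
   that fit the Yang-Baxter pattern by a third one; the remaining crossing is then
   matched by uniqueness. *)
Ltac solve_triangle := match goal with
  | h1 : P ?m0 ?t0 ?t1 ?m1, h2 : P ?b0 ?t1 ?t2 ?b1 |- _ =>
      let h3 := fresh in destruct (bq_ab bq b1 m1) as (? & ? & h3); useI h1 h2 h3
  | h1 : P ?m0 ?t0 ?t1 ?m1, h3 : P ?b1 ?m1 ?m2 ?b2 |- _ =>
      let h2 := fresh in destruct (bq_bd bq t1 b1) as (? & ? & h2); useI h1 h2 h3
  | h2 : P ?b0 ?t1 ?t2 ?b1, h3 : P ?b1 ?m1 ?m2 ?b2 |- _ =>
      let h1 := fresh in destruct (bq_cd bq t1 m1) as (? & ? & h1); useI h1 h2 h3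
  | h1 : P ?b0 ?m0 ?m1 ?b1, h2 : P ?b1 ?t0 ?t1 ?b2 |- _ =>
      let h3 := fresh in destruct (bq_ab bq m1 t1) as (? & ? & h3); useII h1 h2 h3
  | h1 : P ?b0 ?m0 ?m1 ?b1, h3 : P ?m1 ?t1 ?t2 ?m2 |- _ =>
      let h2 := fresh in destruct (bq_ac bq b1 t1) as (? & ? & h2); useII h1 h2 h3
  | h2 : P ?b1 ?t0 ?t1 ?b2, h3 : P ?m1 ?t1 ?t2 ?m2 |- _ =>
      let h1 := fresh in destruct (bq_cd bq m1 b1) as (? & ? & h1); useII h1 h2 h3
  end.

(** The six outer labels stay fixed and only the three sides are relabelled. [r3_geom] leaves
    sixteen choices of [ccw], [dT], [dM], [dB], each settled by one form of the Yang-Baxter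
    equation. *)
Lemma triangle_flip sx sy sz oT oM oB t0 t1 t2 m0 m1 m2 b0 b1 b2 :
  r3_geom sx sy sz oT oM oB ->
  triangle sx sy sz oT oM oB t0 t1 t2 m0 m1 m2 b0 b1 b2 ->
  exists t1' m1' b1',
    triangle sx sy sz (~~ oT) (~~ oM) (~~ oB) t0 t1' t2 m0 m1' m2 b0 b1' b2.
Proof.
case=> ccw [dT [dM [dB]]].
case: ccw dT dM dB => [] [] [] [] /= [-> -> -> [-> -> ->]];
  rewrite /triangle /crossrel /= => -[h1 h2 h3].
all: solve [solve_triangle].
Qed.

Definition coloring (D : gdiag) (col : cr D * bool -> X) : Prop :=
  forall x, crossrel (sgn D x) (col (prev D (x, true))) (col (prev D (x, false)))
                     (col (x, true)) (col (x, false)).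

(** Quantifying over all sublinks [S] is needed for transport: a component that loses its last
    crossing in a move can be kept out of the sublink, so that the nonzero label cannot sit there
    alone. *)
Definition good (D : gdiag) : Prop :=
  forall S : pred (cr D * bool), (forall p, S (nxt D p) = S p) -> (exists p, S p) ->
  exists col, [/\ coloring D col, forall p, supp (col p) = S p & exists p, ~~ zero (col p)].

(* D is D' with the crossings outside [codom e] erased. The erased passages come in
   consecutive pairs (a "head" [h] and its successor) such that the label entering
   the head is the label leaving its successor: this covers isomorphisms (no pair),
   the first move (one pair) and the second move (two pairs). *)
Section Reduction.
Variables (D D' : gdiag) (e : cr D -> cr D') (h : pred (cr D' * bool)).
Local Notation ep p := (e p.1, p.2).
Local Notation kept q := (q.1 \in codom e).
Hypotheses (wfD : wf D) (wfD' : wf D') (e_inj : injective e).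
Hypothesis e_sgn : forall x, sgn D' (e x) = sgn D x.
Hypothesis e_nxt : forall p : cr D * bool, exists k : nat,
  iter k.+1 (nxt D') (ep p) = (e (nxt D p).1, (nxt D p).2) /\
  forall j, (0 < j <= k)%N -> (iter j (nxt D') (ep p)).1 \notin codom e.
Hypothesis h_head : forall q, h q -> [/\ ~~ kept q, ~~ kept (nxt D' q) & ~~ h (nxt D' q)].
Hypothesis h_tail : forall q, ~~ kept q -> ~~ h q -> h (prev D' q).

Let nxtK : cancel (nxt D') (prev D'). Proof. exact: finv_f. Qed.
Let prevK : cancel (prev D') (nxt D'). Proof. exact: f_finv. Qed.
Let prevKD : cancel (prev D) (nxt D). Proof. exact: f_finv. Qed.

(** [back] walks upstream and stops at a surviving passage; thus [anc q p] says that [p] is the last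
    survivor at or before [q]. *)
Let back (q : cr D' * bool) := if kept q then q else prev D' q.
Let anc (q : cr D' * bool) (p : cr D * bool) := fconnect back q (ep p).

Let kept_ep (p : cr D * bool) : kept (ep p). Proof. exact: codom_f. Qed.
Let ep_inj (p p' : cr D * bool) : ep p = ep p' -> p = p'.
Proof. by case: p p' => [x b] [x' b'] [/e_inj -> ->]. Qed.
Let iter_back_ep n (p : cr D * bool) : iter n back (ep p) = ep p.
Proof. by elim: n => //= n ->; rewrite /back kept_ep. Qed.

Let anc_uniq q p p' : anc q p -> anc q p' -> p = p'.
Proof.
move=> /iter_findex; move: (findex _ _ _) => n en /iter_findex.
move: (findex _ _ _) => n' en'; apply: ep_inj.
by rewrite -(iter_back_ep n' p) -en -(iter_back_ep n p') -en' -!iterD addnC.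
Qed.
Let anc_ep p : anc (ep p) p. Proof. exact: connect0. Qed.
Let anc_nxt q p : ~~ kept (nxt D' q) -> anc (nxt D' q) p = anc q p.
Proof.
move=> nk; rewrite /anc fconnect_eqVf; case: eqP => [e0|_] /=.
  by rewrite e0 kept_ep in nk.
by have -> : back (nxt D' q) = q by rewrite /back (negPf nk) nxtK.
Qed.
Let anc_prev (p : cr D * bool) : anc (prev D' (ep p)) (prev D p).
Proof.
have [k [ek nk]] := e_nxt (prev D p); rewrite prevKD /= in ek.
rewrite -ek nxtK.
have : (k <= k)%N by []; move: {1 3}k; elim=> [_|j IH jk]; first exact: anc_ep.
by rewrite iterS anc_nxt; [apply: IH; apply: ltnW | apply: (nk j.+1)].
Qed.

(* The label of the last surviving passage before q, or [y q] on a component of D'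
   without any surviving passage. *)
Let outer (Y : Type) (col : cr D * bool -> Y) (y : cr D' * bool -> Y) q :=
  if [pick p | anc q p] is Some p then col p else y q.

Let outer_anc Y (col : _ -> Y) y q p : anc q p -> outer col y q = col p.
Proof.
by rewrite /outer; case: pickP => [p' /anc_uniq e1 /e1 ->|->].
Qed.
Let outer_nxt Y (col : _ -> Y) y q : (y (nxt D' q) = y q) -> ~~ kept (nxt D' q) ->
  outer col y (nxt D' q) = outer col y q.
Proof. by rewrite /outer => -> nk; under eq_pick do rewrite anc_nxt //. Qed.

(** An erased passage that is not a head is preceded by a head. Two steps upstream therefore jump
    over one pair without changing the label, and induction on the distance to the survivor
    applies. *)
Let nonhead_anc col' q p : (forall q, h q -> col' (nxt D' q) = col' (prev D' q) :> X) ->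
  ~~ h q -> anc q p -> col' q = col' (ep p).
Proof.
move=> L1 nh /iter_findex; move: (findex _ _ _) => n.
elim/ltn_ind: n q nh => n IH q nh; case: (boolP (kept q)) => [kq|nk].
  have -> : iter n back q = q by elim: (n) => //= j ->; rewrite /back kq.
  by move->.
have hp := h_tail _ nk nh; have [k1 k2 k3] := h_head hp.
case: n IH => [|[|n]] IH; first by move=> /= eq; rewrite eq kept_ep in nk.
  by rewrite /= /back (negPf nk) => eq; rewrite eq kept_ep in k1.
have b1 : back q = prev D' q by rewrite /back (negPf nk).
have b2 : back (prev D' q) = prev D' (prev D' q) by rewrite /back (negPf k1).
rewrite !iterSr b1 b2 => en.
rewrite -[q in LHS]prevK L1 //; apply: (IH _ _ _ _ en) => //.
by apply/negP => /h_head[_ _]; rewrite prevK hp.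
Qed.

Hypothesis L1 : forall col, coloring D' col ->
  forall q, h q -> col (nxt D' q) = col (prev D' q).
Hypothesis L3 : forall col, coloring D' col ->
  (forall q, ~~ h q -> zero (col q)) -> forall q, h q -> zero (col q).

Let nh_ep (p : cr D * bool) : ~~ h (ep p).
Proof. by apply/negP => /h_head[]; rewrite kept_ep. Qed.
Let nh_prev_ep (p : cr D * bool) : ~~ h (prev D' (ep p)).
Proof. by apply/negP => /h_head[_]; rewrite prevK kept_ep. Qed.

(** A colouring of [D'] is restricted to the surviving passages. If this restriction were zero, [L1]
    would make all labels outside the heads zero, and [L3] the labels at the heads as well. *)
Lemma good_restrict : good D' -> good D.
Proof.
move=> gD' S S_nxt [p0 Sp0].
(* The default [false] removes from the sublink every component of [D'] without a survivor, so that
   all labels there are zero. *)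
pose S' := outer S (fun=> false).
have S'ep p : S' (ep p) = S p by apply: outer_anc.
have S'_nxt q : S' (nxt D' q) = S' q.
  case: (boolP (kept (nxt D' q))) => [|nk]; last exact: outer_nxt.
  case/codomP=> x ex.
  have [b en] : exists b, nxt D' q = ep (x, b).
    by exists (nxt D' q).2; rewrite /= -ex; case: (nxt D' q).
  rewrite en S'ep -[q]nxtK en /S' (outer_anc _ _ _ _ (anc_prev _)).
  by rewrite -[in LHS](prevKD (x, b)) S_nxt.
have [|col' [c_col s_col [q0 nz]]] := gD' S' S'_nxt; first by exists (ep p0); rewrite S'ep.
exists (fun p : cr D * bool => col' (ep p)); split.
- move=> x; have := c_col (e x); rewrite e_sgn.
  rewrite !(nonhead_anc _ _ _ (L1 c_col) (nh_prev_ep (x, _)) (anc_prev (x, _))) //.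
- by move=> p; rewrite s_col S'ep.
case: (boolP [exists p : cr D * bool, ~~ zero (col' (ep p))]) => [/existsP //|].
rewrite negb_exists => /forallP az; case/negP: nz.
have nhz q : ~~ h q -> zero (col' q).
  move=> nh; case E: [pick p | anc q p] => [p|].
    move: E; case: pickP => // p' a _.
    by rewrite (nonhead_anc _ _ _ (L1 c_col) nh a); apply/negPn/az.
  by apply: (bq_absent_zero bq); rewrite s_col /S' /outer E.
case: (boolP (h q0)) => [hq|]; [exact: (L3 c_col nhz) | exact: nhz].
Qed.

Hypothesis L2 : forall o : cr D' * bool -> X,
  (forall q, ~~ kept (nxt D' q) -> o (nxt D' q) = o q) ->
  exists m : cr D' * bool -> X,
    let col q := if h q then m q else o q in
    (forall q, h q -> supp (m q) = supp (o q)) /\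
    forall x, x \notin codom e ->
      crossrel (sgn D' x) (col (prev D' (x, true))) (col (prev D' (x, false)))
               (col (x, true)) (col (x, false)).

(** Labels of [D] are continued unchanged through the erased passages, and [L2] then relabels only
    the semi-arcs leaving the heads. *)
Lemma good_extend : good D -> good D'.
Proof.
move=> gD S' S'_nxt [q0 Sq0].
have S'_prev q : S' (prev D' q) = S' q by rewrite -{2}(prevK q) S'_nxt.
have S'anc q p : anc q p -> S' q = S' (ep p).
  move=> /iter_findex <-; elim: (findex _ _ _) => //= n ->.
  by rewrite /back; case: ifP.
have S'ep_nxt p : S' (ep (nxt D p)) = S' (ep p).
  by have [k [<- _]] := e_nxt p; elim: k.+1 => //= j IH; rewrite S'_nxt.
have [x0 [nx0 Px0]] := bq_absent bq.
have [v Pv] := bq_ladder bq.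
pose S (p : cr D * bool) := S' (ep p).
(* If no surviving passage lies in the sublink, the everywhere absent colouring of [D] is used; the
   nonzero label must then come from [y]. *)
have [col [c_col s_col nz]] : exists col, [/\ coloring D col,
    forall p, supp (col p) = S p & (exists p, S p) -> exists p, ~~ zero (col p)].
  case: (boolP [exists p, S p]) => [/existsP ex|].
    by have [col [? ? ?]] := gD S S'ep_nxt ex; exists col; split.
  rewrite negb_exists => /forallP nS; exists (fun=> x0); split.
  - by move=> x; rewrite /crossrel; case: ifP => _; case: (Px0 x0).
  - by move=> p; rewrite (negPf (nS p)) (negPf nx0).
  by case=> p Sp; case/negP: (nS p).
(* On components without survivors a constant nonzero label serves; [v 0] is one at hand. *)
pose y q := if S' q then v 0 else x0; pose o := outer col y.
have s_o q : supp (o q) = S' q.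
  rewrite /o /outer; case: pickP => [p a|_]; first by rewrite s_col (S'anc _ _ a).
  by rewrite /y; case: (S' q); [have [-> _ _] := Pv 0 | rewrite (negPf nx0)].
have o_nxt q : ~~ kept (nxt D' q) -> o (nxt D' q) = o q.
  by apply: outer_nxt; rewrite /y S'_nxt.
have [m /= [s_m c_m]] := L2 _ o_nxt.
exists (fun q => if h q then m q else o q); split.
- move=> x; case: (boolP (x \in codom e)) => [/codomP[x' ->]|]; last exact: c_m.
  rewrite !(negPf (nh_prev_ep (x', _))) !(negPf (nh_ep (x', _))) e_sgn.
  rewrite /o !(outer_anc _ _ _ _ (anc_prev (x', _))) !(outer_anc _ _ _ _ (anc_ep (x', _))).
  exact: c_col.
- by move=> q; case: ifP => [hq|_]; rewrite ?s_m ?s_o.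
case: (boolP [exists p, S p]) => [/existsP /nz [p nzp]|].
  by exists (ep p); rewrite (negPf (nh_ep _)) /o (outer_anc _ _ _ _ (anc_ep _)).
rewrite negb_exists => /forallP nS.
(* The head labels [m] might be zero, so the witness is moved off the heads: the predecessor of a
   head is not a head. *)
pose q := if h q0 then prev D' q0 else q0.
have Sq : S' q by rewrite /q; case: ifP; rewrite ?S'_prev.
have nhq : ~~ h q.
  rewrite /q; case: ifPn => // hq0; apply/negP => /h_head[_ _].
  by rewrite prevK hq0.
exists q; rewrite (negPf nhq) /o /outer; case: pickP => [p /S'anc e1|_].
  by case/negP: (nS p); rewrite /S -e1.
by rewrite /y Sq; have [_ ->] := Pv 0.
Qed.
End Reduction.

(** * Isomorphisms and the moves that create or remove crossings *)

Lemma good_iso (D D' : gdiag) (f : cr D -> cr D') :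
  wf D -> wf D' -> bijective f -> (forall x, sgn D' (f x) = sgn D x) ->
  (forall p, nxt D' (f p.1, p.2) = (f (nxt D p).1, (nxt D p).2)) ->
  good D <-> good D'.
Proof.
move=> wD wD' bf f_sgn f_nxt.
have ex : forall p : cr D * bool, exists k : nat,
  iter k.+1 (nxt D') (f p.1, p.2) = (f (nxt D p).1, (nxt D p).2) /\
  forall j, (0 < j <= k)%N -> (iter j (nxt D') (f p.1, p.2)).1 \notin codom f.
  by move=> p; exists 0%N; split=> [|[]//]; rewrite /= f_nxt.
have all_kept x : x \in codom f by case: bf => g _ gK; rewrite -(gK x) codom_f.
split.
- apply: (good_extend pred0 wD wD' (bij_inj bf)) => //.
  by move=> o _; exists o; split=> // x; rewrite all_kept.
- apply: (good_restrict pred0 wD wD' (bij_inj bf)) => //.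
  by move=> q; rewrite all_kept.
Qed.

Lemma good_R1 (D D' : gdiag) (e : cr D -> cr D') (c : cr D') :
  wf D -> wf D' -> extends D D' e ->
  (forall c', (c' \in codom e) = (c' != c)) ->
  (nxt D' (c, true) = (c, false) \/ nxt D' (c, false) = (c, true)) ->
  good D <-> good D'.
Proof.
move=> wD wD' [e_inj e_sgn e_nxt _] kept c_nxt.
have [b nb] : exists b, nxt D' (c, b) = (c, ~~ b).
  by case: c_nxt => ?; [exists true | exists false].
have pK : prev D' (c, ~~ b) = (c, b) by rewrite -nb /prev finv_f.
have pnb : prev D' (c, b) != (c, b).
  apply/eqP => e1; move: nb; rewrite -{1}e1 /prev f_finv // => -[].
  by case: (b).
have h_head q : pred1 (c, b) q ->
    [/\ q.1 \notin codom e, (nxt D' q).1 \notin codom e & ~~ pred1 (c, b) (nxt D' q)].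
  move=> /eqP ->; rewrite nb !kept /= eqxx; split=> //.
  by apply/eqP => -[]; case: (b).
have h_tail q : q.1 \notin codom e -> ~~ pred1 (c, b) q -> pred1 (c, b) (prev D' q).
  case: q => x b'; rewrite kept negbK /= => /eqP -> nq.
  have -> : b' = ~~ b by move: nq; case: (b) (b') => [] []; rewrite ?eqxx.
  by rewrite pK.
(* The loop label [y] occurs twice in the crossing relation, either in both under-in and over-out
   positions of [P] or in the two others. [bq_kink] then equates the entering label [u] and the
   leaving label [w]. *)
have kink_of col : coloring D' col -> let u := col (prev D' (c, b)) in
    let y := col (c, b) in let w := col (c, ~~ b) in
    if b (+) sgn D' c then P u y w y \/ P w y u y else P y u y w \/ P y w y u.
  move/(_ c); move: pK; rewrite /crossrel.
  by case: (b) => /= ->; case: (sgn D' c) => /=; auto.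
have of_kink col : let u := col (prev D' (c, b)) in
    let y := col (c, b) in let w := col (c, ~~ b) in
    w = u -> (if b (+) sgn D' c then P u y u y else P y u y u) ->
    crossrel (sgn D' c) (col (prev D' (c, true))) (col (prev D' (c, false)))
               (col (c, true)) (col (c, false)).
  move: pK; rewrite /crossrel.
  by case: (b) => /= -> ->; case: (sgn D' c).
split.
- apply: (good_extend (pred1 (c, b)) wD wD' e_inj) => // o o_nxt.
  have o1 : o (c, b) = o (prev D' (c, b)).
    by rewrite -{1}(f_finv wD' (c, b)) o_nxt // f_finv // kept eqxx.
  have o2 : o (c, ~~ b) = o (c, b) by rewrite -nb o_nxt // nb kept eqxx.
  have [y [s_y Py]] : exists y, supp y = supp (o (c, b)) /\
      if b (+) sgn D' c then P (o (c, b)) y (o (c, b)) y else P y (o (c, b)) y (o (c, b)).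
    case: (b (+) sgn D' c).
      have [y Py] := bq_kink_under bq (o (c, b)).
      by exists y; split=> //; have [] := bq_supp bq Py.
    have [y Py] := bq_kink_over bq (o (c, b)).
    by exists y; split=> //; have [] := bq_supp bq Py.
  exists (fun=> y) => /=; split=> [q /eqP -> //|x].
  rewrite kept negbK => /eqP ->.
  apply: (of_kink (fun q => if q == (c, b) then y else o q)) => /=; rewrite ?eqxx (negPf pnb) -?o1 //.
  by case: eqP => [[]|//]; case: (b).
apply: (good_restrict (pred1 (c, b)) wD wD' e_inj) => //.
- move=> col /kink_of /= h _ /eqP ->; rewrite nb.
  move: h; case: ifP => _ [] h.
  + by have [_ k] := bq_kink bq h; rewrite k.
  + by have [_ k] := bq_kink bq h; rewrite k.
  + by have [k _] := bq_kink bq h; rewrite k.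
  + by have [k _] := bq_kink bq h; rewrite k.
move=> col /kink_of /= h nz _ /eqP ->.
have z1 : zero (col (prev D' (c, b))) by apply: nz.
have z2 : zero (col (c, ~~ b)) by apply: nz; apply/eqP => -[]; case: (b).
by move: h; case: ifP => _ [] h; have := bq_zero bq h; rewrite z1 z2 ?orbT /=;
  case/(_ isT isT).
Qed.

(* Over-strand x0 x1 x2 and under-strand y0 y1 y2; [same] says that the two strands
   are parallel. *)
Definition bigon (s same : bool) (x0 x1 x2 y0 y1 y2 : X) : Prop :=
  if same then crossrel s x0 y0 x1 y1 /\ crossrel (~~ s) x1 y1 x2 y2
  else crossrel s x0 y1 x1 y2 /\ crossrel (~~ s) x1 y0 x2 y1.

(** As the signs are opposite, the inner labels [x1] and [y1] occupy the same two positions of [P]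
    at both crossings. The four cases use the four uniqueness laws, and [bigon_ex] uses the four
    existence laws in the same way. *)
Lemma bigon_through s same x0 x1 x2 y0 y1 y2 :
  bigon s same x0 x1 x2 y0 y1 y2 -> x0 = x2 /\ y0 = y2.
Proof.
rewrite /bigon /crossrel; case: same s => [] [] /= [h1 h2].
- by have [-> ->] := bq_cd_uniq bq h1 h2.
- by have [-> ->] := bq_ab_uniq bq h1 h2.
- by have [-> ->] := bq_ac_uniq bq h1 h2.
- by have [-> ->] := bq_bd_uniq bq h1 h2.
Qed.

Lemma bigon_ex s same x0 y0 : exists x1 y1, bigon s same x0 x1 x0 y0 y1 y0.
Proof.
rewrite /bigon /crossrel; case: same s => [] [] /=.
- by have [c [d h]] := bq_ab bq y0 x0; exists c, d.
- by have [a [b h]] := bq_cd bq x0 y0; exists b, a.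
- by have [a [c h]] := bq_bd bq x0 y0; exists c, a.
- by have [b [d h]] := bq_ac bq y0 x0; exists b, d.
Qed.

Lemma crossrel_supp s oi ui oo uo : crossrel s oi ui oo uo ->
  supp oi = supp oo /\ supp ui = supp uo.
Proof. by rewrite /crossrel; case: s => h; have [-> ->] := bq_supp bq h. Qed.

Lemma crossrel_zero s oi ui oo uo : crossrel s oi ui oo uo ->
  zero oi || zero oo -> zero ui || zero uo ->
  [/\ zero oi, zero ui, zero oo & zero uo].
Proof.
rewrite /crossrel; case: s => h z1 z2.
  by have [] := bq_zero bq h.
by have [||->->->->] := bq_zero bq h; rewrite // orbC.
Qed.

Lemma bigon_supp s same x0 x1 x2 y0 y1 y2 : bigon s same x0 x1 x2 y0 y1 y2 ->
  supp x1 = supp x0 /\ supp y1 = supp y0.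
Proof.
by rewrite /bigon; case: same => -[/crossrel_supp[-> +] /crossrel_supp[+ +]] => // -> ->.
Qed.

Lemma bigon_zero s same x0 x1 x2 y0 y1 y2 : bigon s same x0 x1 x2 y0 y1 y2 ->
  zero x0 -> zero y0 -> zero y2 -> zero x1 /\ zero y1.
Proof.
rewrite /bigon => + zx zy zy2; case: same => -[/crossrel_zero + _]; rewrite zx ?zy ?zy2 ?orbT;
  by case/(_ isT isT).
Qed.

Lemma good_R2 (D D' : gdiag) (e : cr D -> cr D') (c1 c2 : cr D') :
  wf D -> wf D' -> extends D D' e -> c1 != c2 ->
  (forall c', (c' \in codom e) = (c' != c1) && (c' != c2)) ->
  sgn D' c1 != sgn D' c2 ->
  nxt D' (c1, true) = (c2, true) ->
  (nxt D' (c1, false) = (c2, false) \/ nxt D' (c2, false) = (c1, false)) ->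
  good D <-> good D'.
Proof.
move=> wD wD' [e_inj e_sgn e_nxt _] n12 kept sg nT nF.
have [same nF'] : exists same : bool, nxt D' (if same then c1 else c2, false) =
    (if same then c2 else c1, false) by case: nF => ?; [exists true | exists false].
(* These are the two crossings in the order in which the under-strand meets them. *)
pose u1 := if same then c1 else c2; pose u2 := if same then c2 else c1.
have {}nF' : nxt D' (u1, false) = (u2, false) := nF'.
have nk1 : c1 \notin codom e by rewrite kept eqxx.
have nk2 : c2 \notin codom e by rewrite kept eqxx andbF.
have nku1 : u1 \notin codom e by rewrite /u1; case: (same).
have nku2 : u2 \notin codom e by rewrite /u2; case: (same).
have n21 : c2 != c1 by rewrite eq_sym.
have nu21 : u2 != u1 by rewrite /u1 /u2; case: (same).
have sg2 : sgn D' c2 = ~~ sgn D' c1 by move: sg; case: (sgn D' c1) (sgn D' c2) => [] [].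
have pT : prev D' (c2, true) = (c1, true) by rewrite -nT /prev finv_f.
have pF : prev D' (u2, false) = (u1, false) by rewrite -nF' /prev finv_f.
pose h := pred2 (c1, true) (u1, false).
have h1 : h (c1, true) by rewrite /h /= eqxx.
have h2 : h (u1, false) by rewrite /h /= eqxx orbT.
have nh1 : h (c2, true) = false by rewrite /h /= !xpair_eqE (negPf n21) andbF.
have nh2 : h (u2, false) = false by rewrite /h /= !xpair_eqE (negPf nu21) andbF.
have h_head q : h q -> [/\ q.1 \notin codom e, (nxt D' q).1 \notin codom e & ~~ h (nxt D' q)].
  by case/orP => /eqP ->; rewrite ?nT ?nF' ?nh1 ?nh2.
have h_tail q : q.1 \notin codom e -> ~~ h q -> h (prev D' q).
  have cE x : x \notin codom e -> (x = c1) \/ (x = c2).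
    by rewrite kept negb_and !negbK => /orP[] /eqP; auto.
  have uE x : x \notin codom e -> (x = u1) \/ (x = u2).
    by move/cE; rewrite /u1 /u2; case: (same) => -[]; auto.
  case: q => x []; last first.
    by rewrite [_.1]/= => /uE[->|->]; rewrite ?h2 ?pF ?h2.
  by rewrite [_.1]/= => /cE[->|->]; rewrite ?h1 ?pT ?h1.
have nhp1 : ~~ h (prev D' (c1, true)).
  by apply/negP => /h_head[_ _]; rewrite f_finv // h1.
have nhp2 : ~~ h (prev D' (u1, false)).
  by apply/negP => /h_head[_ _]; rewrite f_finv // h2.
pose rel (col : cr D' * bool -> X) := bigon (sgn D' c1) same
    (col (prev D' (c1, true))) (col (c1, true)) (col (c2, true))
    (col (prev D' (u1, false))) (col (u1, false)) (col (u2, false)).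
have relP col : rel col <-> forall x, x \notin codom e ->
      crossrel (sgn D' x) (col (prev D' (x, true))) (col (prev D' (x, false)))
               (col (x, true)) (col (x, false)).
  rewrite /rel /bigon -sg2; move: pF; rewrite /u1 /u2.
  case: (same) => pF'; split.
  - by case=> r1 r2 x; rewrite kept negb_and !negbK => /orP[] /eqP ->; rewrite ?pT ?pF'.
  - by move=> r; have := r _ nk1; have := r _ nk2; rewrite pT pF'.
  - by case=> r1 r2 x; rewrite kept negb_and !negbK => /orP[] /eqP ->; rewrite ?pT ?pF'.
  - by move=> r; have := r _ nk1; have := r _ nk2; rewrite pT pF'.
split.
- apply: (good_extend h wD wD' e_inj) => // o o_nxt.
  have o_prev q : q.1 \notin codom e -> o (prev D' q) = o q.
    by move=> nk; rewrite -{2}(f_finv wD' q) o_nxt // f_finv.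
  have [x1 [y1 r]] := bigon_ex (sgn D' c1) same (o (c1, true)) (o (u1, false)).
  have /bigon_supp [sx sy] := r.
  pose m (q : cr D' * bool) := if q.2 then x1 else y1; exists m; split.
    by move=> q /orP[] /eqP ->.
  apply: (proj1 (relP (fun q => if h q then m q else o q))).
  rewrite /rel (negPf nhp1) (negPf nhp2) h1 h2 nh1 nh2.
  by rewrite !o_prev // -nT -nF' !o_nxt ?nT ?nF'.
apply: (good_restrict h wD wD' e_inj) => //.
- move=> col c_col.
  have : rel col by apply/relP => x _; apply: c_col.
  rewrite /rel => /bigon_through[eT eF].
  by move=> q /orP[] /eqP ->; rewrite ?nT ?nF'.
move=> col c_col nz.
have : rel col by apply/relP => x _; apply: c_col.
rewrite /rel => /bigon_zero r.
have [|||zT zF] := r; try by apply: nz; rewrite ?nh2.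
by move=> q /orP[] /eqP ->.
Qed.

Lemma triangle_supp sx sy sz oT oM oB t0 t1 t2 m0 m1 m2 b0 b1 b2 :
  triangle sx sy sz oT oM oB t0 t1 t2 m0 m1 m2 b0 b1 b2 ->
  [/\ supp t1 = supp t0, supp m1 = supp m0 & supp b1 = supp b0].
Proof.
by case: oT oM oB => [] [] []; rewrite /triangle /=;
  case=> /crossrel_supp[? ?] /crossrel_supp[? ?] /crossrel_supp[? ?]; split; congruence.
Qed.

Lemma triangle_zero sx sy sz oT oM oB t0 t1 t2 m0 m1 m2 b0 b1 b2 :
  triangle sx sy sz oT oM oB t0 t1 t2 m0 m1 m2 b0 b1 b2 ->
  zero t0 -> zero t2 -> zero m0 -> zero m2 -> zero b0 -> zero b2 ->
  [/\ zero t1, zero m1 & zero b1].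
Proof.
move=> + zt0 zt2 zm0 zm2 zb0 zb2; case: oT oM oB => [] [] []; rewrite /triangle /=;
  case=> /crossrel_zero; rewrite ?zt0 ?zt2 ?zm0 ?zm2 ?zb0 ?zb2 ?orbT;
  case/(_ isT isT) => ? ? ? ?;
  case/crossrel_zero; rewrite ?zt0 ?zt2 ?zm0 ?zm2 ?zb0 ?zb2 ?orbT // => ? ? ? ?;
  case/crossrel_zero; rewrite ?zt0 ?zt2 ?zm0 ?zm2 ?zb0 ?zb2 ?orbT // => ? ? ? ?.
Qed.

(** * The third move *)

Section R3.
Variables (D : gdiag) (x y z : cr D).
Hypotheses (wD : wf D) (xy : x != y) (yz : y != z) (xz : x != z).
Local Notation tau := (r3tau D x y z).
Local Notation D3 := (r3move D x y z).

Let yx : y != x. Proof. by rewrite eq_sym. Qed.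
Let zy : z != y. Proof. by rewrite eq_sym. Qed.
Let zx : z != x. Proof. by rewrite eq_sym. Qed.
Let neq := (negPf xy, negPf yz, negPf xz, negPf yx, negPf zy, negPf zx).
Let ev := (xpair_eqE, eqxx, neq, andbF, andbT).

Let tau_xt : tau (x, true) = (y, true).
Proof. by rewrite /r3tau /tsw ?ev /= ?ev. Qed.
Let tau_yt : tau (y, true) = (x, true).
Proof. by rewrite /r3tau /tsw ?ev /= ?ev. Qed.
Let tau_xf : tau (x, false) = (z, true).
Proof. by rewrite /r3tau /tsw ?ev /= ?ev. Qed.
Let tau_zt : tau (z, true) = (x, false).
Proof. by rewrite /r3tau /tsw ?ev /= ?ev. Qed.
Let tau_yf : tau (y, false) = (z, false).
Proof. by rewrite /r3tau /tsw ?ev /= ?ev. Qed.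
Let tau_zf : tau (z, false) = (y, false).
Proof. by rewrite /r3tau /tsw ?ev /= ?ev. Qed.
Let tau_other w b : w != x -> w != y -> w != z -> tau (w, b) = (w, b).
Proof. by move=> /negPf wx /negPf wy /negPf wz; rewrite /r3tau /tsw !(xpair_eqE, wx, wy, wz). Qed.
Let tauE := (tau_xt, tau_yt, tau_xf, tau_zt, tau_yf, tau_zf).

Let tauK : involutive tau.
Proof.
case=> w b; have [->|wx] := eqVneq w x; first by case: b; rewrite !tauE.
have [->|wy] := eqVneq w y; first by case: b; rewrite !tauE.
have [->|wz] := eqVneq w z; first by case: b; rewrite !tauE.
by rewrite !tau_other.
Qed.

Lemma wf_r3move : wf D3.
Proof. by move=> p q /= /(inv_inj tauK) /wD /(inv_inj tauK). Qed.

Let prev3 p : prev D3 p = tau (prev D (tau p)).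
Proof.
apply: wf_r3move; rewrite [LHS](f_finv wf_r3move) /= tauK.
by rewrite (f_finv wD) tauK.
Qed.

Variables oT oM oB : bool.
Hypotheses
  (nT : if oT then nxt D (x, true) = (y, true) else nxt D (y, true) = (x, true))
  (nM : if oM then nxt D (x, false) = (z, true) else nxt D (z, true) = (x, false))
  (nB : if oB then nxt D (y, false) = (z, false) else nxt D (z, false) = (y, false))
  (geom : r3_geom (sgn D x) (sgn D y) (sgn D z) oT oM oB).

Let prevE p q : nxt D p = q -> prev D q = p.
Proof. by move=> <-; rewrite /prev finv_f. Qed.

(** The earlier of the two passages on each strand of the triangle; the semi-arc leaving it is the
    side itself, and [tau] sends it to the later passage. *)
Let fT := if oT then (x, true) else (y, true).
Let fM := if oM then (x, false) else (z, true).
Let fB := if oB then (y, false) else (z, false).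

Let first p := [|| p == fT, p == fM | p == fB].
Let prev_last : [/\ prev D (tau fT) = fT, prev D (tau fM) = fM & prev D (tau fB) = fB].
Proof.
rewrite /fT /fM /fB; split.
- by case: oT nT => /prevE; rewrite tauE.
- by case: oM nM => /prevE; rewrite tauE.
- by case: oB nB => /prevE; rewrite tauE.
Qed.
Let last_notfirst : [/\ ~~ first (tau fT), ~~ first (tau fM) & ~~ first (tau fB)].
Proof.
by rewrite /first /fT /fM /fB; case: (oT) (oM) (oB) => [] [] []; rewrite !tauE !ev.
Qed.
Let first_prev p : first (prev D p) -> [|| p == tau fT, p == tau fM | p == tau fB].
Proof.
have [pT pM pB] := prev_last.
have pinj : injective (prev D) by apply: (can_inj (f_finv wD)).
by rewrite /first -{1}pT -{1}pM -{1}pB !(inj_eq pinj).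
Qed.
Let notfirst_prev_first : [/\ ~~ first (prev D fT), ~~ first (prev D fM) & ~~ first (prev D fB)].
Proof.
split; apply/negP => /first_prev; apply/negP;
by rewrite /first /fT /fM /fB; case: (oT) (oM) (oB) => [] [] []; rewrite !tauE !ev.
Qed.

(** The three sides are relabelled by [triangle_flip]. If every new label were zero, the unchanged
    outer labels would vanish, and [triangle_zero] would force the old sides to vanish too. *)
Lemma good_r3move : good D -> good D3.
Proof.
move=> gD S' S'_nxt [p0 Sp0].
pose S p := S' (tau p).
have S_nxt p : S (nxt D p) = S p by rewrite /S -(S'_nxt (tau p)) /= tauK.
have [|col [c_col s_col [q0 nz]]] := gD S S_nxt; first by exists (tau p0); rewrite /S tauK.
have tri : triangle (sgn D x) (sgn D y) (sgn D z) oT oM oB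
    (col (prev D fT)) (col fT) (col (tau fT)) (col (prev D fM)) (col fM) (col (tau fM))
    (col (prev D fB)) (col fB) (col (tau fB)).
  have := (c_col x, c_col y, c_col z); rewrite /triangle /fT /fM /fB.
  case: (oT) nT => /prevE eT; case: (oM) nM => /prevE eM; case: (oB) nB => /prevE eB;
  by rewrite !tauE eT eM eB => -[[? ?] ?]; split.
have [t1 [m1 [b1 tri']]] := triangle_flip geom tri.
(* The semi-arcs of D and of the moved diagram correspond through tau; only the three
     sides of the triangle get new labels. *)
pose kap q := if q == fT then t1 else if q == fM then m1 else if q == fB then b1 else col q.
have kap_nf q : ~~ first q -> kap q = col q.
  by rewrite /first !negb_or /kap => /and3P[/negPf -> /negPf -> /negPf ->].
have kT : kap fT = t1 by rewrite /kap eqxx.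
have kM : kap fM = m1.
  have /negPf nMT : fM != fT by rewrite /fT /fM; case: (oT) (oM) => [] []; rewrite !ev.
  by rewrite /kap eqxx nMT.
have kB : kap fB = b1.
  have /negPf nBT : fB != fT by rewrite /fT /fB; case: (oT) (oB) => [] []; rewrite !ev.
  have /negPf nBM : fB != fM by rewrite /fM /fB; case: (oM) (oB) => [] []; rewrite !ev.
  by rewrite /kap eqxx nBT nBM.
have [pT pM pB] := prev_last; have [lT lM lB] := last_notfirst.
have [npT npM npB] := notfirst_prev_first.
have kpT := kap_nf _ npT; have kpM := kap_nf _ npM; have kpB := kap_nf _ npB.
have klT := kap_nf _ lT; have klM := kap_nf _ lM; have klB := kap_nf _ lB.
have kplT : kap (prev D (tau fT)) = t1 by rewrite pT kT.
have kplM : kap (prev D (tau fM)) = m1 by rewrite pM kM.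
have kplB : kap (prev D (tau fB)) = b1 by rewrite pB kB.
have col3 : coloring D3 (fun p => kap (tau p)).
  have [tx ty tz] := tri'.
  move=> w; rewrite !prev3 !tauK.
  have [->|wx] := eqVneq w x.
    move: tx kT kM kpT kpM klT klM kplT kplM; rewrite /fT /fM !tauE.
    by case: (oT) (oM) => [] []; rewrite !tauE => + e1 e2 e3 e4 e5 e6 e7 e8;
      rewrite ?e1 ?e2 ?e3 ?e4 ?e5 ?e6 ?e7 ?e8.
  have [->|wy] := eqVneq w y.
    move: ty kT kB kpT kpB klT klB kplT kplB; rewrite /fT /fB !tauE.
    by case: (oT) (oB) => [] []; rewrite !tauE => + e1 e2 e3 e4 e5 e6 e7 e8;
      rewrite ?e1 ?e2 ?e3 ?e4 ?e5 ?e6 ?e7 ?e8.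
  have [->|wz] := eqVneq w z.
    move: tz kM kB kpM kpB klM klB kplM kplB; rewrite /fM /fB !tauE.
    by case: (oM) (oB) => [] []; rewrite !tauE => + e1 e2 e3 e4 e5 e6 e7 e8;
      rewrite ?e1 ?e2 ?e3 ?e4 ?e5 ?e6 ?e7 ?e8.
  have nf b : ~~ first (w, b) /\ ~~ first (prev D (w, b)).
    split; last (apply/negP => /first_prev; apply/negP);
    rewrite /first /fT /fM /fB; case: (oT) (oM) (oB) => [] [] [];
    by rewrite ?tauE !(xpair_eqE, negPf wx, negPf wy, negPf wz).
  rewrite !tau_other // !kap_nf; try by case: (nf true); case: (nf false).
  exact: c_col.
have s_prev q : S (prev D q) = S q by rewrite -{2}(f_finv wD q) S_nxt.
have s_kap q : supp (kap q) = S q.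
  have [sT sM sB] := triangle_supp tri'; rewrite !s_col !s_prev in sT sM sB.
  rewrite /kap; case: eqP => [->//|_]; case: eqP => [->//|_]; case: eqP => [->//|_].
  exact: s_col.
exists (fun p => kap (tau p)); split=> //.
  by move=> p; rewrite s_kap /S tauK.
case: (boolP [exists p, ~~ zero (kap (tau p))]) => [/existsP //|].
rewrite negb_exists => /forallP az; case/negP: nz.
have zk q : zero (kap q) by rewrite -(tauK q); apply/negPn/az.
have znf q : ~~ first q -> zero (col q) by move/kap_nf <-.
have [||||||zT zM zB] := triangle_zero tri; try exact: znf.
case: (boolP (first q0)) => [|/znf //].
by rewrite /first => /or3P[] /eqP ->.
Qed.

Lemma r3move_order :
  [/\ if ~~ oT then nxt D3 (x, true) = (y, true) else nxt D3 (y, true) = (x, true),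
      if ~~ oM then nxt D3 (x, false) = (z, true) else nxt D3 (z, true) = (x, false) &
      if ~~ oB then nxt D3 (y, false) = (z, false) else nxt D3 (z, false) = (y, false)].
Proof.
split.
- by case: oT nT => /= e; rewrite !tauE e !tauE.
- by case: oM nM => /= e; rewrite !tauE e !tauE.
- by case: oB nB => /= e; rewrite !tauE e !tauE.
Qed.

Lemma nxt_r3move2 p : nxt (r3move D3 x y z) p = nxt D p.
Proof.
have -> : nxt (r3move D3 x y z) p = tau (tau (nxt D (tau (tau p)))) by [].
by rewrite !tauK.
Qed.
End R3.

Lemma good_R3 (D : gdiag) (x y z : cr D) :
  wf D -> r3_ok D x y z -> good D <-> good (r3move D x y z).
Proof.
move=> wD [xy yz xz [oT [oM [oB [nT nM nB geom]]]]].
split; first exact: (@good_r3move D x y z wD xy yz xz oT oM oB nT nM nB geom).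
have w3 : wf (r3move D x y z) by apply: wf_r3move.
(* Reversing all three directions reverses the orders and keeps the signs, because [vsign] only
   compares directions. *)
have geom' : r3_geom (sgn D x) (sgn D y) (sgn D z) (~~ oT) (~~ oM) (~~ oB).
  case: geom => ccw [dT [dM [dB g]]]; exists ccw, (~~ dT), (~~ dM), (~~ dB).
  by case: ccw dT dM dB g => [] [] [] [] /= [-> -> -> [-> -> ->]].
have [nT' nM' nB'] := @r3move_order D x y z xy yz xz oT oM oB nT nM nB.
move/(@good_r3move (r3move D x y z) x y z w3 xy yz xz _ _ _ nT' nM' nB' geom') => g33.
(* Moving twice restores [nxt] pointwise, so the identity on crossings is an isomorphism back to
   [D]. *)
apply/(@good_iso D (r3move (r3move D x y z) x y z) id) => //.
- exact: wf_r3move.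
- by exists id.
- by move=> [w b]; rewrite nxt_r3move2 //; case: (nxt D _).
Qed.

Lemma good_step (D D' : gdiag) : step D D' -> good D <-> good D'.
Proof.
case=> {D D'}.
- by move=> D D' f wD wD' bf fs fn _; apply: good_iso bf fs fn.
- by move=> D D' e c wD wD' ex ke nc; apply: good_R1 ex ke nc.
- by move=> D D' e c1 c2 wD wD' ex n12 ke sg nT nF; apply: good_R2 ex n12 ke sg nT nF.
- by move=> D x y z; apply: good_R3.
Qed.

Lemma good_vequiv (D D' : gdiag) : vequiv D D' -> good D <-> good D'.
Proof.
by elim=> {D D'} [D D' /good_step[? ?]|D|D D' _ [? ?]|D D' D'' _ [? ?] _ [? ?]]; split; auto.
Qed.

(** * Colourings of planar diagrams by Alexander numberings *)

Lemma classical_good (D : gdiag) : classical D -> good D.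
Proof.
case=> wD euler S S_nxt [p0 Sp0].
have S_prev p : S (prev D p) = S p by rewrite -[in RHS](f_finv wD p) S_nxt.
pose w p : rat := (S p)%:R.
have w_div x : w (x, true) + w (x, false) = w (prev D (x, true)) + w (prev D (x, false)).
  by rewrite /w !S_prev.
have [f [f_sigma f_alpha]] := planar_potential wD euler w_div.
have [x0 [nx0 Px0]] := bq_absent bq.
have [v Pv] := bq_ladder bq.
(* The potential is only rational, but it jumps by 0 or 1 across each semi-arc, so its floor jumps
   by the same amount and is an integral index. *)
pose n p := Num.floor (f (p, true)).
exists (fun p => if S p then v (n p) else x0); split; last first.
- by exists p0; rewrite Sp0; have [] := Pv (n p0).
- by move=> p; case: (S p); [have [] := Pv (n p) | apply/negbTE].
move=> x.
have f_out o : f (sigma D ((x, o), true)) = f ((x, o), true) + (S (x, o))%:R.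
  by rewrite f_sigma f_alpha.
have f_in o : f (sigma D ((x, o), false)) = f (prev D (x, o), true).
  by rewrite f_sigma.
have f_in' o : f ((x, o), false) = f (prev D (x, o), true) + (S (x, o))%:R.
  by rewrite -S_prev -f_alpha /alpha /= f_finv.
have floor1 (q : rat) : Num.floor (q + 1) = Num.floor q + 1.
  by rewrite (floorDrz q) // floor1.
move: (f_out true) (f_out false) (f_in true) (f_in false) (f_in' true) (f_in' false).
rewrite /crossrel /sigma /= !S_prev /n.
case: (sgn D x) => /= e1 e2 e3 e4 e5 e6.
- rewrite e1 e4 (etrans (esym e3) e6).
  case: (S (x, true)); case: (S (x, false)); rewrite ?addr0 ?floor1;
  by [have [] := Pv (Num.floor (f (prev D (x, false), true))) | case: (Px0 x0)
     | case: (Px0 (v (Num.floor (f (prev D (x, false), true)))))].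
rewrite e2 e3 (etrans (esym e4) e5).
case: (S (x, true)); case: (S (x, false)); rewrite ?addr0 ?floor1;
by [have [] := Pv (Num.floor (f (prev D (x, true), true))) | case: (Px0 x0)
   | case: (Px0 (v (Num.floor (f (prev D (x, true), true)))))].
Qed.
End Coloring.

(** * The presentation matrix *)

Section Determinant.
Variables (F K : fieldType) (iota : {rmorphism F -> K}) (lam mu : F) (s t : K).
Hypotheses (s2 : s ^+ 2 = iota (- lam)) (t2 : t ^+ 2 = iota mu).

Definition qmat (q : quat F) : 'M[K]_2 := \matrix_(i, j) qembed iota s t q i j.

Lemma qmatD x y : qmat (qadd x y) = qmat x + qmat y.
Proof.
apply/matrixP=> i j; rewrite !mxE /qembed.
by case: ifP => _; case: ifP => _; rewrite /= !rmorphD /=; ring.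
Qed.

Lemma qmatN x : qmat (qopp x) = - qmat x.
Proof.
apply/matrixP=> i j; rewrite !mxE /qembed.
by case: ifP => _; case: ifP => _; rewrite /= !rmorphN /=; ring.
Qed.

Lemma qmatB x y : qmat (qsub x y) = qmat x - qmat y.
Proof. by rewrite qmatD qmatN. Qed.

Lemma qmat0 : qmat (qzero F) = 0.
Proof.
apply/matrixP=> i j; rewrite !mxE /qembed.
by case: ifP => _; case: ifP => _; rewrite /= !rmorph0 /=; ring.
Qed.

Lemma qmat1 : qmat (qone F) = 1.
Proof.
apply/matrixP=> i j; rewrite !mxE /qembed.
by case: i j => [[|[|//]] ?] [[|[|//]] ?]; rewrite /= ?rmorph0 ?rmorph1; ring.
Qed.

Lemma qmatM x y : qmat (qmul lam mu x y) = qmat x * qmat y.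
Proof.
have elam : iota lam = - (s * s) by rewrite -expr2 s2 rmorphN opprK.
have emu : iota mu = t * t by rewrite -expr2 t2.
apply/matrixP=> i j; rewrite !mxE /qembed !big_ord_recl big_ord0 !mxE /qembed.
by case: i j => [[|[|//]] ?] [[|[|//]] ?];
  rewrite /= !(rmorphD, rmorphN, rmorphM) /= ?elam ?emu; ring.
Qed.

Lemma qmat_inv x y : is_qinv lam mu x y ->
  qmat x \is a GRing.unit /\ qmat y = (qmat x)^-1.
Proof.
case=> xy yx.
have u : qmat x \is a GRing.unit.
  by apply/unitrP; exists (qmat y); rewrite -!qmatM xy yx qmat1.
by split=> //; apply: (mulrI u); rewrite divrr // -qmatM xy qmat1.
Qed.

(** The entries [Y u] are the rows of a nonzero matrix annihilated by the matrix of [f], which is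
    therefore singular. Row vectors are allowed because a label is itself a square matrix. *)
Lemma detT_kernel (T : finType) n (f : T -> T -> K) (Y : T -> 'rV[K]_n) :
  (forall u, \sum_v f u v *: Y v = 0) -> (exists u, Y u != 0) -> detT f = 0.
Proof.
move=> ker [u nz]; apply/eqP; rewrite /detT; set M := \matrix_(_, _) _.
apply: contraNT nz => nd.
have uM : M \in unitmx by rewrite unitmxE unitfE.
pose Z : 'M[K]_(#|T|, n) := \matrix_j Y (enum_val j).
have MZ : M *m Z = 0.
  apply/row_matrixP => i; rewrite row0 row_mul mulmx_sum_row -[RHS](ker (enum_val i)).
  rewrite (reindex (@enum_rank T)) /=; last exact/onW_bij/enum_rank_bij.
  by apply: eq_bigr => v _; rewrite !mxE rowK enum_rankK.
have Z0 : Z = 0 by rewrite -[Z](mulKmx uM) MZ mulmx0.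
by have := rowK (fun j => Y (enum_val j)) (enum_rank u); rewrite -/Z Z0 row0 enum_rankK => <-.
Qed.

Variables (A B Ai Bi : quat F).
Hypothesis sw : is_ncswitch lam mu A B Ai Bi.

Lemma ncswitch_matrix :
  [/\ qmat A \is a GRing.unit, qmat B \is a GRing.unit, 1 - qmat A \is a GRing.unit &
   [/\ qmat Ai = (qmat A)^-1, qmat Bi = (qmat B)^-1 &
      (qmat A)^-1 * (qmat B)^-1 * qmat A * qmat B
        - qmat B * (qmat A)^-1 * (qmat B)^-1 * qmat A
      = (qmat B)^-1 * qmat A * qmat B - qmat A]].
Proof.
have [/qmat_inv[uA eA] /qmat_inv[uB eB] [y /qmat_inv[uA1 _]] _ e] := sw.
split=> //.
  by rewrite -opprB unitrN -qmat1 -qmatB.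
by have := congr1 qmat e; rewrite !(qmatB, qmatM) eA eB !mulrA.
Qed.

Lemma Delta0_good (D : gdiag) : (0 < #|cr D|)%N ->
  good (swrel (qmat A) (qmat B)) isSome (@zlab 'M[K]_2) D ->
  Delta0 iota s t lam mu A B Ai Bi D = 0.
Proof.
have [uA uB uA1 [eA eB _]] := ncswitch_matrix.
move=> /card_gt0P[x0 _] gD.
(* The sublink is the whole link, so no label is [None]; a crossing is needed to make it
   nonempty. *)
have [||col [c_col s_col [q nz]]] := gD xpredT => //; first by exists (x0, true).
pose X p := odflt 0 (col p).
have colE p : col p = Some (X p) by have := s_col p; rewrite /X; case: (col p).
have switch x :
  X (lab_c D x) = qmat A * X (lab_a D x) + qmat B * X (lab_b D x) /\
  X (lab_d D x) = swC (qmat A) (qmat B) * X (lab_a D x) + swD (qmat A) (qmat B) * X (lab_b D x).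
  have := c_col x; rewrite /crossrel /lab_a /lab_b /lab_c /lab_d !colE.
  by case: (sgn D x) => /= -[[->] [->]].
have sum_qif (q0 : quat F) p : \sum_g qmat (qif (p == g) q0) * X g = qmat q0 * X p.
  rewrite (bigD1 p) //= eqxx big1 ?addr0 // => g; rewrite eq_sym => /negPf ->.
  by rewrite qmat0 mul0r.
have pres r : \sum_g qmat (presmat lam mu A B Ai Bi D r g) * X g = 0.
  have [e1 e2] := switch r.1.
  rewrite /presmat; case: r.2.
    under eq_bigr do rewrite !(qmatD, qmatN) !mulrDl mulNr.
    by rewrite big_split sumrN big_split /= !sum_qif qmat1 mul1r e1 subrr.
  under eq_bigr do rewrite !(qmatD, qmatN) !mulrDl mulNr.
  rewrite big_split sumrN big_split /= !sum_qif qmat1 mul1r e2.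
  rewrite /switchC /switchD !(qmatB, qmatM) qmat1 eA eB /swC /swD !mulrA.
  by rewrite subrr.
(* Each matrix label is cut into its two rows to match the index set of the scalar matrix, which
   pairs a passage with a row number. *)
apply: (@detT_kernel _ 2 _ (fun u => row u.2 (X u.1))).
  move=> [r i].
  transitivity (row i (\sum_g qmat (presmat lam mu A B Ai Bi D r g) * X g)); last first.
    by rewrite pres row0.
  rewrite raddf_sum -(pair_bigA _ (fun g l =>
    qembed iota s t (presmat lam mu A B Ai Bi D r g) i l *: row l (X g))) /=.
  apply: eq_bigr => g _; rewrite row_mul mulmx_sum_row.
  by apply: eq_bigr => l _; rewrite !mxE.
have Xq : X q != 0 by [].
suff [i] : exists i, row i (X q) != 0 by exists (q, i).
apply/existsP; apply: contraNT Xq; rewrite negb_exists => /forallP h.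
by apply/eqP/row_matrixP => i; rewrite row0; apply/eqP/negPn/h.
Qed.
End Determinant.

Theorem theorem9p3 (F : fieldType) (K : closedFieldType)
  (iota : {rmorphism F -> K}) (lam mu : F) (s t : K)
  (A B Ai Bi : quat F) (D : gdiag) :
  (2%N \notin [pchar F]) -> lam != 0 -> mu != 0 ->
  algebraic_over iota ->
  s ^+ 2 = iota (- lam) -> t ^+ 2 = iota mu ->
  is_ncswitch lam mu A B Ai Bi ->
  wf D -> (0 < #|cr D|)%N -> represents_classical D ->
  Delta0 iota s t lam mu A B Ai Bi D = 0.
Proof.
move=> _ _ _ _ s2 t2 sw _ D_gt0 [D0 [cD0 eqD]].
have [uA uB uA1 [_ _ fund]] := ncswitch_matrix iota s t s2 t2 sw.
have bq := swrel_biquandle uA uB uA1 fund.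
apply: (Delta0_good s2 t2 sw D_gt0).
by apply/(good_vequiv bq eqD); apply: classical_good.
Qed.
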